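(* Consider the impulsive Lasota-Wazewska model with delays that are multiples of the period, $$N'(t)+a(t)N(t)=\sum_{i=1}^n b_i(t)e^{-\beta_i(t)N(t-m_i\omega)}\quad(0\le t\ne t_k),\qquad \Delta N(t_k):=N(t_k^+)-N(t_k)=I_k(N(t_k))\quad(k=1,2,\dots),\tag{L}$$ in the setting described in the context, where $m_i\in\mathbb{N}$, and denote $\bar m=\max_{1\le i\le n}m_i$. Assume that there exist constants $a_1,\dots,a_p$ and $b_1,\dots,b_p$ with $b_k>-1$ such that $$b_k\le\frac{I_k(x)-I_k(y)}{x-y}\le a_k,\qquad x,y\ge0,\ x\ne y,\ k=1,\dots,p,$$ that $\prod_{k=1}^p(1+a_k)\le1$, that $I_k(0)=0$ for $k\in\mathbb{N}$, and that there is a positive $\omega$-periodic solution $N^*(t)$ of (L). If $$B^{\bar m}\Big(\overline{\beta}\,\overline{N^*}\,(e^{\overline{\beta N^*}}-1)\Big)^{1/2}\Big(1-e^{-\bar m\int_0^\omega a(u)\,du}\Big)\left[1-\Big(1-e^{-\int_0^\omega a(u)\,du}\Big)^{-1}\sum_{k=1}^p\min(b_k,0)\right]<1,$$ where $B=\max_{1\le l,j\le p}\prod_{k=1}^j(1+b_{l+k})^{-1}$, then $N^*(t)$ attracts any positive solution $N(t)$ of (L), i.e. $\lim_{t\to\infty}(N(t)-N^*(t))=0$.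
   Context: Setting. $\omega>0$ and $n,p,m_1,\dots,m_n$ are positive integers. The functions $a,b_i,\beta_i:\mathbb{R}\to(0,\infty)$, $1\le i\le n$, are continuous, positive and $\omega$-periodic. $0<t_1<t_2<\cdots$, $t_k\to\infty$; $I_k:[0,\infty)\to\mathbb{R}$ are continuous with $u+I_k(u)>0$ for $u>0$; $t_{k+p}=t_k+\omega$ and $I_{k+p}(u)=I_k(u)$ for $k\in\mathbb{N}$, $u>0$; exactly $p$ impulse instants $t_1,\dots,t_p$ lie in $[0,\omega]$. The constants are extended by $a_{k+p}=a_k$, $b_{k+p}=b_k$. Solutions are left continuous and $N'(t)$ is the left-hand derivative. Notation: $\overline{\beta}=\max_{0\le t\le\omega}\max_{1\le i\le n}\beta_i(t)$, $\overline{N^*}=\max_{0\le t\le\omega}N^*(t)$, $\overline{\beta N^*}=\max_{0\le t\le\omega}\max_{1\le i\le n}\beta_i(t)N^*(t)$ (suprema if not attained). Positive solutions of (L) are the solutions with initial condition $N(\theta)=\phi(\theta)$ on $[-\bar m\omega,0]$, where $\phi:[-\bar m\omega,0]\to[0,\infty)$ is continuous with $\phi(0)>0$. *)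

(* Defs.v *)
From HB Require Import structures.
From mathcomp Require Import all_boot all_order all_algebra.
From mathcomp Require Import all_classical all_reals all_analysis.
Set Implicit Arguments.
Unset Strict Implicit.
Unset Printing Implicit Defensive.
Import Order.TTheory GRing.Theory Num.Theory.
Import numFieldNormedType.Exports.
Local Open Scope classical_set_scope.
Local Open Scope ring_scope.

(* Impulse data (t_k, I_k, and the constants a_k, b_k) are sequences on [nat]
   used only at indices k >= 1; their value at 0 is never constrained. *)

Definition is_left_derive (R : realType) (f : R -> R) (t l : R) : Prop :=
  (f s - f t) / (s - t) @[s --> t^'-] --> l.

(* Solutions on (0, +oo). No regularity is asked at or before t = 0: an
   w-periodic solution has jumps at the points t_k - j w, which may be
   negative, or zero when t_p = w. *)
Definition is_solution (R : realType) (w : R) (n : nat) (m : 'I_n -> nat)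
    (a : R -> R) (b beta : 'I_n -> R -> R) (tau : nat -> R) (I : nat -> R -> R)
    (N : R -> R) : Prop :=
  [/\ forall t, 0 < t -> N s @[s --> t^'-] --> N t,
      forall t, 0 < t -> (forall k, (1 <= k)%N -> t <> tau k) ->
        N s @[s --> t] --> N t,
      forall t, 0 < t -> (forall k, (1 <= k)%N -> t <> tau k) ->
        exists2 dN, is_left_derive N t dN &
          dN + a t * N t =
          \sum_(i < n) b i t * expR (- beta i t * N (t - (m i)%:R * w))
    & forall k, (1 <= k)%N ->
        N s - N (tau k) @[s --> (tau k)^'+] --> I k (N (tau k)) ].

Definition mbar (n : nat) (m : 'I_n -> nat) : nat := \max_(i < n) m i.

(* The right-continuity at 0 says that N starts from phi without a jump: 0 is
   not an impulse instant. *)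
Definition is_positive_solution (R : realType) (w : R) (n : nat)
    (m : 'I_n -> nat) (a : R -> R) (b beta : 'I_n -> R -> R) (tau : nat -> R)
    (I : nat -> R -> R) (N : R -> R) : Prop :=
  [/\ is_solution w m a b beta tau I N,
      N s @[s --> 0^'+] --> N 0
    & exists phi : R -> R,
      [/\ {within `[- ((mbar m)%:R * w), 0], continuous phi},
          forall x, x \in `[- ((mbar m)%:R * w), 0] -> 0 <= phi x,
          0 < phi 0
        & forall x, x \in `[- ((mbar m)%:R * w), 0] -> N x = phi x ] ].

Definition sup_period (R : realType) (w : R) (f : R -> R) : R :=
  sup [set f t | t in `[0, w]].

(* All the quantities maximized below are positive, so the default value 0 of
   the iterated maximum is harmless. *)
Definition beta_bar (R : realType) (w : R) (n : nat) (beta : 'I_n -> R -> R) :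
    R :=
  sup_period w (fun t => \big[Num.max/0]_(i < n) beta i t).

Definition betaN_bar (R : realType) (w : R) (n : nat) (beta : 'I_n -> R -> R)
    (N : R -> R) : R :=
  sup_period w (fun t => \big[Num.max/0]_(i < n) (beta i t * N t)).

Definition Bmax (R : realType) (p : nat) (bk : nat -> R) : R :=
  \big[Num.max/0]_(1 <= l < p.+1) \big[Num.max/0]_(1 <= j < p.+1)
    \prod_(1 <= k < j.+1) (1 + bk (l + k)%N)^-1.

Definition int_period (R : realType) (w : R) (a : R -> R) : R :=
  \int[lebesgue_measure]_(u in `[0, w]) a u.

(* Main.v *)
Require Import Defs.
From HB Require Import structures.
From mathcomp Require Import all_boot all_order all_algebra.
From mathcomp Require Import all_classical all_reals all_analysis.
From mathcomp Require Import ring lra.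
Set Implicit Arguments.
Unset Strict Implicit.
Unset Printing Implicit Defensive.
Import Order.TTheory GRing.Theory Num.Theory.
Import numFieldNormedType.Exports.
Local Open Scope classical_set_scope.
Local Open Scope ring_scope.

(** Write x = N - N*.  Since N*(t - m_i w) = N*(t), between impulses x solves
    x' + a x = sum_i G_i (exp(- beta_i x(t - m_i w)) - 1) with
    G_i = b_i exp(- beta_i N* ), while N* itself solves N*' + a N* = g with
    g = sum_i G_i.  The right-hand side for x is a negative feedback of the past,
    and it is comparable to g:
    - if x >= - v N* in the past (with 0 <= v <= 1), it is at most q1 v g,
      where q1 = exp(sup beta N* ) - 1, by convexity of exp;
    - if x <= u N* in the past, it is at least - q2 u g, where
      q2 = sup beta * sup N*;
    - it is nonpositive (nonnegative) if x was positive (negative) during the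
      whole past delay.
    So everything reduces to a one-sided estimate for the linear equation:
    a curve y with y' + a y <= C g, with y' + a y <= 0 after a delay D = m w of
    positivity, and whose positive values jump by factors at most 1 + a_k,
    satisfies limsup y / N* <= C Q for an explicit constant Q
    ([one_sided_bound]).  Applied alternately to x and to - x it turns the bound
    - x <= v N* into - x <= (q1 q2 Q^2 v + eps) N*; the smallness condition says
    q1 q2 Q^2 < 1 ([loop_gain_lt1]), and iterating from the initial bound
    x > - N*, that is N > 0 ([supersolution_pos]), gives x / N* -> 0
    ([alternating_contraction]).

    For the one-sided estimate let A' = a and, for a sequence d of positive jump
    factors, let P_d(t) be the product of the d_k with tau_k < t.  Multiplying by
    exp(A) / P_d removes the damping term and the jumps by the factors d_k.  Let
    up_k = 1 + a_k, the largest jump factor y can have, and let st_k be the jump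
    factors of N*.  Then
    - nu = exp(A) N* / P_up has downward jumps; adding them back yields a
      continuous nondecreasing function [prim] with derivative exp(A) g / P_up,
      that is, a primitive obtained without integrating anything;
    - zeta = exp(A) y / P_up satisfies zeta' <= C prim' and does not jump up
      while y >= 0.
    If t0 is the last zero of y before t, then zeta(t) is at most C times the
    increment of prim over [t0, min(t, t0 + D)].  As prim(t + w) is an affine
    function of prim(t) with slope at least 1, this increment is at most
    prim(t) - prim(t - D) ([prim_increment_shift]), and this is Q nu(t): the
    increments over successive periods form a geometric progression
    ([prim_window]), and over one period the increment is compared with that of
    mu = exp(A) N* / P_st, which is continuous too ([prim_period]).  If y has no
    zero after some time, zeta eventually decreases while nu tends to infinity.

    Since N and N* have only left derivatives, all monotonicity statements rest
    on [nonincreasing_of_left_derive]. *)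

(** * Monotonicity from left derivatives *)

Lemma avoid_seq (R : realType) (E : seq R) (x y : R) : x < y ->
  exists2 c, x < c < y & c \notin E.
Proof.
move=> xy; have: exists x' y', [/\ x <= x', x' < y', y' <= y &
    forall c, x' < c < y' -> c \notin E].
  elim: E => [|e E [x1 [y1 [xx1 xy1 yy1 h]]]]; first by exists x, y.
  have [ey|ye] := ltP e ((x1 + y1) / 2).
    exists ((x1 + y1) / 2), y1; split; [lra|lra|lra|] => c /andP[c1 c2].
    rewrite inE negb_or h ?andbT; last lra.
    by apply/eqP => ce; rewrite ce in c1; lra.
  exists x1, ((x1 + y1) / 2); split; [lra|lra|lra|] => c /andP[c1 c2].
  rewrite inE negb_or h ?andbT; last lra.
  by apply/eqP => ce; rewrite ce in c2; lra.
move=> [x1 [y1 [xx1 xy1 yy1 h]]].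
by exists ((x1 + y1) / 2); [lra|apply: h; lra].
Qed.

(** After subtracting a small multiple of the identity the left derivative is
    negative.  If the conclusion failed, choose a level [c] strictly between the
    end values and avoiding the values at the exceptional points, and let [u] be
    the first time at which [c] is crossed upwards.  The one-sided limits force the
    value [c] at [u]; but a negative left derivative at [u] means that the
    function was above [c] just before. *)
Lemma nonincreasing_of_left_derive (R : realType) (f : R -> R) (E : seq R)
    (s t : R) : s <= t ->
  (forall u, s < u <= t -> f v @[v --> u^'-] --> f u) ->
  (forall u, s <= u < t -> exists2 l, f v @[v --> u^'+] --> l & l <= f u) ->
  (forall u, s < u < t -> u \notin E ->
     exists2 l, is_left_derive f u l & l <= 0) ->
  f t <= f s.
Proof.
move=> st fl fr fd; rewrite leNgt; apply/negP => fst.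
have {}st : s < t.
  by rewrite lt_neqAle st andbT; apply: contraTneq fst => ->; rewrite ltxx.
pose eps := (f t - f s) / (2 * (t - s)).
have eps0 : 0 < eps by rewrite divr_gt0 // ?subr_gt0 // mulr_gt0 // subr_gt0.
pose phi u := f u - eps * (u - s).
have phist : phi s < phi t.
  rewrite /phi subrr mulr0 subr0 ltrBrDr -ltrBrDl /eps.
  have -> : (f t - f s) / (2 * (t - s)) * (t - s) = (f t - f s) / 2.
    by field; rewrite subr_eq0 gt_eqF.
  by rewrite ltr_pdivrMr // mulr_natr mulr2n ltrDl subr_gt0.
have [c /andP[sc ct] cE] := avoid_seq [seq phi e | e <- E] phist.
have phil u : s < u <= t -> phi v @[v --> u^'-] --> phi u.
  move=> hu; apply: cvgB; first exact: fl.
  apply: cvg_at_left_filter; apply: cvgM; first exact: cvg_cst.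
  by apply: cvgB; [exact: cvg_id|exact: cvg_cst].
have phir u : s <= u < t -> exists2 l, phi v @[v --> u^'+] --> l & l <= phi u.
  move=> hu; have [l lf lu] := fr u hu; exists (l - eps * (u - s)); last first.
    by rewrite lerD2r.
  apply: cvgB => //.
  apply: cvg_at_right_filter; apply: cvgM; first exact: cvg_cst.
  by apply: cvgB; [exact: cvg_id|exact: cvg_cst].
pose S := [set u | s <= u <= t /\ forall v, s <= v <= u -> phi v <= c].
have S_s : S s.
  split; first by rewrite lexx ltW.
  by move=> v /le_anti <-; exact: ltW.
have S_sup : has_sup S.
  by split; [exists s|exists t => u [/andP[]]].
pose u := sup S.
have su : s <= u by exact: (ub_le_sup S_sup.2 S_s).
have ut : u <= t by apply: ge_sup => [|v [/andP[]]//]; exists s.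
have below v : s <= v -> v < u -> phi v <= c.
  move=> sv vu; have [||x [_ Sx]] := @sup_adherent _ S (u - v); rewrite ?subr_gt0 //.
  by rewrite opprB addrC subrK => vx; apply: Sx; rewrite sv ltW.
have uc : phi u <= c.
  have [us|us] := eqVneq s u; first by rewrite -us ltW.
  have {}us : s < u by rewrite lt_neqAle us.
  apply: (cvgr_to_le (phil u _)); first by rewrite us.
  near=> v; apply: below; near: v; last exact: nbhs_left_lt.
  exact: nbhs_left_ge.
have {}ut : u < t.
  rewrite lt_neqAle ut andbT; apply: contraTneq uc => ->.
  by rewrite -ltNge.
have [|l lphi lu] := phir u; first by rewrite su.
(* Otherwise the level is not exceeded just after u, and u is not the supremum. *)
have cu : c <= phi u.
  rewrite leNgt; apply/negP => uc'.
  have /cvgr_lt : phi v @[v --> u^'+] --> l by [].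
  move=> /(_ c (le_lt_trans lu uc')) hc.
  have [e [/= e0 he]] : exists e, 0 < e /\ forall v, u < v < u + e -> phi v < c.
    move: hc; rewrite near_withinE => /nbhs_ballP[e /= e0 he].
    exists e; split => // v /andP[uv ve]; apply: he => //=.
    by rewrite /ball /= distrC ger0_norm ?subr_ge0 ?ltW // ltrBlDl.
  pose u1 := Num.min t (u + e / 2).
  have u1t : u1 <= t by rewrite ge_min lexx.
  have uu1 : u < u1 by rewrite lt_min ut ltrDl divr_gt0.
  have u1e : u1 < u + e.
    by apply: le_lt_trans (_ : u + e / 2 < _); [rewrite ge_min lexx orbT|lra].
  suff /(ub_le_sup S_sup.2) : S u1 by rewrite leNgt uu1.
  split; first by rewrite u1t andbT (le_trans su) // ltW.
  move=> v /andP[sv vu1]; case: (ltgtP v u) => [vu|uv|->]; first exact: below.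
    by rewrite ltW // he // uv (le_lt_trans vu1).
  exact: uc.
have {cu}uc : phi u = c by apply/le_anti; rewrite uc.
have {}su : s < u.
  rewrite lt_neqAle su andbT; apply: contraTneq sc => ->.
  by rewrite uc ltxx.
have uE : u \notin E.
  by apply: contra cE => uE; rewrite -uc; apply: map_f.
have [||d fd' d0] := fd u; rewrite ?su //.
have hd := @cvgr_lt _ _ _ _ _ _ fd' _ (le_lt_trans d0 eps0).
near u^'- => v.
have vu : v < u by near: v; exact: nbhs_left_lt.
have : (f v - f u) / (v - u) < eps by near: v; exact: hd.
rewrite ltr_ndivrMr ?subr_lt0 // => h.
have : phi v <= c by apply: below => //; near: v; exact: nbhs_left_ge.
rewrite leNgt => /negP; apply; rewrite -uc /phi; lra.
Unshelve. all: by end_near. Qed.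

(** * Calculus of piecewise differentiable curves *)

Lemma left_derive_near (R : realType) (f g : R -> R) (t l : R) :
  (\forall s \near t^'-, f s = g s) -> f t = g t ->
  is_left_derive f t l -> is_left_derive g t l.
Proof.
move=> fg fgt; apply: cvg_trans; apply: near_eq_cvg.
near=> s; congr (_ / _); rewrite fgt; congr (_ - _).
by near: s; exact: fg.
Unshelve. all: by end_near. Qed.

Lemma left_derive_cvg (R : realType) (f : R -> R) (t l : R) :
  is_left_derive f t l -> f s @[s --> t^'-] --> f t.
Proof.
move=> fl.
have h : (f s - f t) / (s - t) * (s - t) + f t @[s --> t^'-] --> l * (t - t) + f t.
  apply: cvgD; last exact: cvg_cst.
  apply: cvgM => //; apply: cvgB; last exact: cvg_cst.
  by apply: cvg_at_left_filter; exact: cvg_id.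
rewrite subrr mulr0 add0r in h; apply: cvg_trans h; apply: near_eq_cvg.
near=> s; have st : s < t by near: s; exact: nbhs_left_lt.
by rewrite divfK ?subrK // subr_eq0 lt_eqF.
Unshelve. all: by end_near. Qed.

Lemma left_derive_cst (R : realType) (c t : R) :
  is_left_derive (fun=> c) t 0.
Proof.
rewrite /is_left_derive; under eq_fun do rewrite subrr mul0r.
exact: cvg_cst.
Qed.

Lemma left_deriveD (R : realType) (f g : R -> R) (t l k : R) :
  is_left_derive f t l -> is_left_derive g t k ->
  is_left_derive (fun s => f s + g s) t (l + k).
Proof.
move=> fl gk.
have h : (f s - f t) / (s - t) + (g s - g t) / (s - t) @[s --> t^'-] --> l + k.
  by apply: cvgD.
apply: cvg_trans h; apply: near_eq_cvg.
by near=> s => /=; rewrite -mulrDl; congr (_ / _); ring.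
Unshelve. all: by end_near. Qed.

Lemma left_deriveM (R : realType) (f g : R -> R) (t l k : R) :
  is_left_derive f t l -> is_left_derive g t k ->
  is_left_derive (fun s => f s * g s) t (l * g t + f t * k).
Proof.
move=> fl gk; have fc := left_derive_cvg fl.
have h : (f s - f t) / (s - t) * g t + f s * ((g s - g t) / (s - t))
    @[s --> t^'-] --> l * g t + f t * k.
  by apply: cvgD; apply: cvgM => //; exact: cvg_cst.
apply: cvg_trans h; apply: near_eq_cvg.
by near=> s => /=; rewrite mulrA [_ / _ * _]mulrAC -mulrDl; congr (_ / _); ring.
Unshelve. all: by end_near. Qed.

Lemma left_deriveZ (R : realType) (f : R -> R) (c t l : R) :
  is_left_derive f t l -> is_left_derive (fun s => c * f s) t (c * l).
Proof.
move=> fl; have := left_deriveM (left_derive_cst c t) fl.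
by rewrite mul0r add0r.
Qed.

Lemma left_derive_derive (R : realType) (f : R -> R) (t l : R) :
  is_derive t (1 : R) f l -> is_left_derive f t l.
Proof.
move=> /is_derive1_caratheodory[g [fg gc <-]].
have h : g s @[s --> t^'-] --> g t by exact: cvg_at_left_filter.
apply: cvg_trans h; apply: near_eq_cvg.
near=> s; have st : s < t by near: s; exact: nbhs_left_lt.
by rewrite fg mulfK // subr_eq0 lt_eqF.
Unshelve. all: by end_near. Qed.

Section curves.
Context {R : realType} (tau : nat -> R) (nimp : R -> nat).
Hypothesis tau_incr : forall k, (1 <= k)%N -> tau k < tau k.+1.
Hypothesis nimpP : forall t k, (1 <= k)%N -> (tau k < t) = (k <= nimp t)%N.

Definition off_tau (t : R) := forall k, (1 <= k)%N -> t <> tau k.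

Lemma tau_lt j k : (1 <= j)%N -> (j < k)%N -> tau j < tau k.
Proof.
move=> j1; elim: k => // k IH; rewrite ltnS leq_eqVlt => /orP[/eqP <-|jk].
  exact: tau_incr.
by apply: lt_trans (IH jk) _; apply: tau_incr; apply: leq_trans j1 (ltnW jk).
Qed.

Lemma nimp_le s t : s <= t -> (nimp s <= nimp t)%N.
Proof.
move=> st; have [->//|k0] := posnP (nimp s).
by rewrite -nimpP // (lt_le_trans _ st) // nimpP.
Qed.

Lemma nimp_left t : \forall s \near t^'-, nimp s = nimp t.
Proof.
have [k0|k0] := posnP (nimp t).
  near=> s; apply/eqP; rewrite k0 -leqn0 -k0; apply: nimp_le.
  by near: s; exact: nbhs_left_le.
near=> s; apply/eqP; rewrite eqn_leq nimp_le /=; last first.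
  by near: s; exact: nbhs_left_le.
rewrite -nimpP //; near: s; apply: nbhs_left_gt; by rewrite nimpP.
Unshelve. all: by end_near. Qed.

Lemma nimp_right t : off_tau t -> \forall s \near t^'+, nimp s = nimp t.
Proof.
move=> ot; have tk : t < tau (nimp t).+1.
  rewrite lt_neqAle; apply/andP; split; first by apply/eqP; exact: ot.
  by rewrite leNgt nimpP // ltnn.
near=> s; apply/eqP; rewrite eqn_leq andbC nimp_le /=; last first.
  by near: s; exact: nbhs_right_ge.
rewrite -ltnS ltnNge -nimpP // -leNgt; near: s; exact: nbhs_right_le.
Unshelve. all: by end_near. Qed.

Lemma nimp_tau k : (1 <= k)%N -> nimp (tau k) = k.-1.
Proof.
case: k => // k _ /=; apply/eqP; rewrite eqn_leq; apply/andP; split.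
  by rewrite -ltnS ltnNge -nimpP // ltxx.
by case: k => // k; rewrite -nimpP // tau_lt.
Qed.

Lemma nimp_tau_right k : (1 <= k)%N -> \forall s \near (tau k)^'+, nimp s = k.
Proof.
move=> k1; near=> s; apply/eqP; rewrite eqn_leq; apply/andP; split.
  rewrite -ltnS ltnNge -nimpP // -leNgt; near: s; apply: nbhs_right_le.
  exact: tau_incr.
by rewrite -nimpP //; near: s; exact: nbhs_right_gt.
Unshelve. all: by end_near. Qed.

(** Left continuous curves on (0, +oo), continuous with left derivative [df] off
    the instants [tau k] and with right limit [fp k] at [tau k].  The class is
    stable under sums and products, so rescaled solutions are differentiated
    without returning to limits. *)
Definition impulsive_curve (f df : R -> R) (fp : nat -> R) : Prop :=
  [/\ forall t, 0 < t -> f s @[s --> t^'-] --> f t,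
      forall t, 0 < t -> off_tau t -> f s @[s --> t^'+] --> f t,
      forall t, 0 < t -> off_tau t -> is_left_derive f t (df t)
    & forall k, (1 <= k)%N -> f s @[s --> (tau k)^'+] --> fp k].

Lemma impulsive_curve_nonincreasing f df fp s t :
  impulsive_curve f df fp -> 0 < s -> s <= t ->
  (forall u, s < u < t -> off_tau u -> df u <= 0) ->
  (forall k, (1 <= k)%N -> s <= tau k < t -> fp k <= f (tau k)) ->
  f t <= f s.
Proof.
move=> [fl fr fd fj] s0 st fd0 fj0.
apply: (@nonincreasing_of_left_derive R f [seq tau k | k <- iota 1 (nimp t)] s t) => //.
- by move=> u /andP[su _]; apply: fl; exact: lt_trans su.
- move=> u /andP[su ut]; have [[k k1 uk]|h] := pselect (exists2 k, (1 <= k)%N & u = tau k).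
    exists (fp k); first by rewrite uk; exact: fj.
    by rewrite uk; apply: fj0 => //; rewrite -uk su ut.
  exists (f u) => //; apply: fr; first exact: lt_le_trans su.
  by move=> k k1 uk; apply: h; exists k.
- move=> u /andP[su ut] uE; have ou : off_tau u.
    move=> k k1 uk; move: uE; rewrite uk map_f // mem_iota k1 add1n ltnS.
    by rewrite -nimpP // -uk.
  exists (df u); last by apply: fd0 => //; rewrite su.
  by apply: fd => //; exact: lt_trans su.
Qed.

Lemma impulsive_curve_eq f f' df df' fp fp' :
  (forall t, f t = f' t) -> (forall t, df t = df' t) ->
  (forall k, (1 <= k)%N -> fp k = fp' k) ->
  impulsive_curve f df fp -> impulsive_curve f' df' fp'.
Proof.
move=> /funext -> /funext -> fpE [fl fr fd fj]; split=> // k k1.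
by rewrite -fpE //; exact: fj.
Qed.

Lemma impulsive_curveD f df fp g dg gp :
  impulsive_curve f df fp -> impulsive_curve g dg gp ->
  impulsive_curve (fun t => f t + g t) (fun t => df t + dg t)
    (fun k => fp k + gp k).
Proof.
move=> [fl fr fd fj] [gl gr gd gj]; split=> [t t0|t t0 ot|t t0 ot|k k1].
- by apply: cvgD; [exact: fl|exact: gl].
- by apply: cvgD; [exact: fr|exact: gr].
- by apply: left_deriveD; [exact: fd|exact: gd].
- by apply: cvgD; [exact: fj|exact: gj].
Qed.

Lemma impulsive_curveZ c f df fp : impulsive_curve f df fp ->
  impulsive_curve (fun t => c * f t) (fun t => c * df t) (fun k => c * fp k).
Proof.
move=> [fl fr fd fj]; split=> [t t0|t t0 ot|t t0 ot|k k1].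
- by apply: cvgM; [exact: cvg_cst|exact: fl].
- by apply: cvgM; [exact: cvg_cst|exact: fr].
- by apply: left_deriveZ; exact: fd.
- by apply: cvgM; [exact: cvg_cst|exact: fj].
Qed.

Lemma impulsive_curveM f df fp g dg gp :
  impulsive_curve f df fp -> impulsive_curve g dg gp ->
  impulsive_curve (fun t => f t * g t) (fun t => df t * g t + f t * dg t)
    (fun k => fp k * gp k).
Proof.
move=> [fl fr fd fj] [gl gr gd gj]; split=> [t t0|t t0 ot|t t0 ot|k k1].
- by apply: cvgM; [exact: fl|exact: gl].
- by apply: cvgM; [exact: fr|exact: gr].
- by apply: left_deriveM; [exact: fd|exact: gd].
- by apply: cvgM; [exact: fj|exact: gj].
Qed.

(** Step functions that change only at the [tau k] have derivative zero: they
    carry the jump factors and the jump corrections. *)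
Lemma impulsive_curve_step (c : nat -> R) :
  impulsive_curve (fun t => c (nimp t)) (fun=> 0) c.
Proof.
split=> [t t0|t t0 ot|t t0 ot|k k1].
- by apply: cvg_near_cst; apply: filterS (nimp_left t) => s ->.
- by apply: cvg_near_cst; apply: filterS (nimp_right ot) => s ->.
- apply: (left_derive_near _ _ (left_derive_cst (c (nimp t)) t)) => //.
  by apply: filterS (nimp_left t) => s ->.
- by apply: cvg_near_cst; apply: filterS (nimp_tau_right k1) => s ->.
Qed.

Lemma impulsive_curve_derive (f df : R -> R) : (forall k, (1 <= k)%N -> 0 < tau k) ->
  (forall t : R, 0 < t -> is_derive t (1 : R) f (df t)) ->
  impulsive_curve f df (fun k => f (tau k)).
Proof.
move=> tau_gt0 fd.
have fc (t : R) : 0 < t -> f x @[x --> t] --> f t.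
  move=> t0; apply/differentiable_continuous/derivable1_diffP.
  by have [] := fd t t0.
split=> [t t0|t t0 ot|t t0 ot|k k1].
- by apply: cvg_at_left_filter; exact: fc.
- by apply: cvg_at_right_filter; exact: fc.
- by apply: left_derive_derive; exact: fd.
- by apply: cvg_at_right_filter; apply: fc; exact: tau_gt0.
Qed.

End curves.

(** * Comparison with a positive periodic solution of a linear equation *)

Lemma period_reduction (R : realType) (w t : R) : 0 < w -> w <= t ->
  exists (j : nat) (s : R), w <= s <= w + w /\ t = s + j%:R * w.
Proof.
move=> w0 wt; have [n tn] : exists n : nat, t <= n.+1%:R * w.
  exists (Num.bound (t / w)); rewrite -ler_pdivrMr //.
  have /ltW/le_trans -> // := archi_boundP (divr_ge0 (le_trans (ltW w0) wt) (ltW w0)).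
  by rewrite ler_nat.
elim: n t wt tn => [|n IH] t wt tn.
  by exists 0%N, t; split; [lra|lra].
have [t2|t2] := leP t (w + w); first by exists 0%N, t; split; [lra|lra].
have [||j [s [sw ts]]] := IH (t - w); first lra.
  by move: tn; rewrite -[n.+2]addn1 natrD; lra.
by exists j.+1, s; split=> //; rewrite -addn1 natrD; lra.
Qed.

Section linear_comparison.
Context {R : realType} (tau : nat -> R) (nimp : R -> nat) (w : R) (p : nat).
Implicit Types (s t M : R) (d : nat -> R).
Hypothesis w_gt0 : 0 < w.
Hypothesis tau_incr : forall k, (1 <= k)%N -> tau k < tau k.+1.
Hypothesis tau_gt0 : forall k, (1 <= k)%N -> 0 < tau k.
Hypothesis tau_per : forall k, (1 <= k)%N -> tau (k + p)%N = tau k + w.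
Hypothesis nimpP : forall (t : R) k, (1 <= k)%N -> (tau k < t) = (k <= nimp t)%N.
Hypothesis nimp_per : forall t : R, 0 < t -> nimp (t + w) = (nimp t + p)%N.

Variables (a A : R -> R) (Aw : R).
Hypothesis A_derive : forall t : R, 0 < t -> is_derive t (1 : R) A (a t).
Hypothesis A_per : forall t : R, 0 < t -> A (t + w) = A t + Aw.
Hypothesis Aw_gt0 : 0 < Aw.

Definition prod_before (d : nat -> R) (t : R) := \prod_(1 <= k < (nimp t).+1) d k.

Definition rescaled (d : nat -> R) (u : R -> R) (t : R) :=
  expR (A t) / prod_before d t * u t.

Lemma prod_pos (d : nat -> R) (j k : nat) : (forall i, (1 <= i)%N -> 0 < d i) ->
  (1 <= j)%N -> 0 < \prod_(j <= i < k) d i.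
Proof.
move=> d0 j1; rewrite big_nat; apply: prodr_gt0 => i /andP[ji _].
by apply: d0; exact: leq_trans ji.
Qed.

Lemma prod_before_gt0 d t : (forall k, (1 <= k)%N -> 0 < d k) ->
  0 < prod_before d t.
Proof. by move=> d0; apply: prod_pos. Qed.

Lemma prod_before_per d t : 0 < t ->
  (forall k, (1 <= k)%N -> d (k + p)%N = d k) ->
  prod_before d (t + w) = prod_before d t * \prod_(1 <= k < p.+1) d k.
Proof.
move=> t0 dp; rewrite /prod_before nimp_per // addnC -addnS.
rewrite (big_cat_nat (n := p.+1)) //=; last by rewrite ?addnS ltnS leq_addr.
rewrite mulrC; congr (_ * _).
rewrite -[p.+1]add1n big_addn addKn big_nat [RHS]big_nat.
by apply: eq_bigr => i /andP[i1 _]; exact: dp.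
Qed.

Lemma sum_before_per (c : nat -> R) (l : R) t : 0 < t ->
  (forall k, (1 <= k)%N -> c (k + p)%N = l * c k) ->
  \sum_(1 <= k < (nimp (t + w)).+1) c k =
  \sum_(1 <= k < p.+1) c k + l * \sum_(1 <= k < (nimp t).+1) c k.
Proof.
move=> t0 dp; rewrite nimp_per // addnC -addnS.
rewrite (big_cat_nat (n := p.+1)) //=; last by rewrite ?addnS ltnS leq_addr.
congr (_ + _); rewrite mulr_sumr.
rewrite -[p.+1]add1n big_addn addKn big_nat [RHS]big_nat.
by apply: eq_bigr => i /andP[i1 _]; exact: dp.
Qed.


(** The factor exp(A) absorbs the damping term, the product absorbs jumps by
    the factors [d k]. *)
Lemma rescaled_curve (d : nat -> R) (u du : R -> R) (up : nat -> R) :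
  impulsive_curve tau u du up ->
  impulsive_curve tau (rescaled d u)
    (fun t => expR (A t) / prod_before d t * (du t + a t * u t))
    (fun k => expR (A (tau k)) / \prod_(1 <= i < k.+1) d i * up k).
Proof.
move=> uc.
have Ec : impulsive_curve tau (expR \o A) (fun t => expR (A t) * a t)
    (fun k => expR (A (tau k))).
  apply: impulsive_curve_derive => // t t0.
  exact: is_derive1_comp (is_derive_expR (A t)) (A_derive t0).
have Sc := impulsive_curve_step tau_incr nimpP
  (fun k => (\prod_(1 <= i < k.+1) d i)^-1).
apply: impulsive_curve_eq (impulsive_curveM (impulsive_curveM Ec Sc) uc) => //.
by move=> t /=; rewrite /prod_before; ring.
Qed.

Lemma prod_tau (d : nat -> R) k : (1 <= k)%N ->
  \prod_(1 <= i < k.+1) d i = prod_before d (tau k) * d k.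
Proof.
by move=> k1; rewrite big_nat_recr //= /prod_before (nimp_tau tau_incr nimpP) // prednK.
Qed.

(** Rescaled by the lower jump factors [lo], the curve is nondecreasing as long
    as it is positive, so it cannot reach zero at a first time. *)
Lemma supersolution_pos (lo : nat -> R) (u du : R -> R) (up : nat -> R) :
  (forall k, (1 <= k)%N -> 0 < lo k) ->
  impulsive_curve tau u du up ->
  (forall t : R, 0 < t -> off_tau tau t -> 0 <= du t + a t * u t) ->
  (forall k, (1 <= k)%N -> 0 < u (tau k) -> lo k * u (tau k) <= up k) ->
  (\forall s \near 0^'+, 0 < u s) ->
  forall t : R, 0 < t -> 0 < u t.
Proof.
move=> lo0 uc du0 up_ge; rewrite near_withinE => /nbhs_ballP[e /= e0 he].
have {}he s : 0 < s -> s < e -> 0 < u s.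
  by move=> s0 se; apply: he => //; rewrite /ball /= sub0r normrN gtr0_norm.
move=> t t0; rewrite ltNge; apply/negP => ut.
pose S := [set s : R | 0 < s /\ u s <= 0].
have S_inf : has_inf S.
  by split; [exists t|exists 0 => s [/ltW]].
pose t1 := inf S.
have et1 : e <= t1.
  apply: lb_le_inf; first by exists t.
  move=> s [s0 us]; rewrite leNgt; apply/negP => /(he s s0).
  by rewrite ltNge us.
have t10 : 0 < t1 by exact: lt_le_trans et1.
have before s : 0 < s -> s < t1 -> 0 < u s.
  move=> s0 st1; rewrite ltNge; apply/negP => us.
  by have := ge_inf S_inf.2 (conj s0 us); rewrite leNgt st1.
pose s1 := t1 / 2; have s10 : 0 < s1 by rewrite divr_gt0.
have s1t1 : s1 < t1 by rewrite /s1; lra.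
have E0 s : 0 < expR (A s) / prod_before lo s.
  by rewrite divr_gt0 ?expR_gt0 // prod_before_gt0.
have hc := impulsive_curveZ (-1) (rescaled_curve lo uc).
have : -1 * rescaled lo u t1 <= -1 * rescaled lo u s1.
  apply: (impulsive_curve_nonincreasing nimpP hc) => //; first exact: ltW.
    move=> s /andP[s1s st1] os; rewrite mulN1r oppr_le0 mulr_ge0 ?(ltW (E0 s)) //.
    by rewrite du0 // (lt_trans s10).
  move=> k k1 /andP[s1k kt1]; rewrite !mulN1r lerN2 prod_tau // /rescaled.
  have uk : 0 < u (tau k) by apply: before => //; exact: tau_gt0.
  have -> : expR (A (tau k)) / (prod_before lo (tau k) * lo k) * up k =
    expR (A (tau k)) / prod_before lo (tau k) * (up k / lo k).
    by field; rewrite !gt_eqF ?lo0 // prod_before_gt0.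
  apply: ler_wpM2l; first exact: ltW.
  by rewrite ler_pdivlMr ?lo0 // mulrC up_ge.
rewrite !mulN1r lerN2 => h.
have ut1 : 0 < u t1.
  have : 0 < rescaled lo u t1.
    by apply: lt_le_trans h; rewrite mulr_gt0 // before.
  by rewrite /rescaled pmulr_rgt0.
have after : \forall s \near t1^'+, 0 < u s.
  have [_ ur _ uj] := uc.
  have [[k k1 tk]|hk] := pselect (exists2 k, (1 <= k)%N & t1 = tau k).
    rewrite tk in ut1 *; apply: (@cvgr_gt _ _ _ _ _ _ (uj k k1)).
    by apply: lt_le_trans (up_ge k k1 ut1); rewrite mulr_gt0 ?lo0.
  apply: (@cvgr_gt _ _ _ _ _ _ (ur _ t10 _)) => //.
  by move=> k k1 tk; apply: hk; exists k.
move: after; rewrite near_withinE => /nbhs_ballP[r /= r0 hr].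
have [s [s0 us] sr] := inf_adherent r0 S_inf.
have := ge_inf S_inf.2 (conj s0 us); rewrite -/t1 le_eqVlt => /orP[/eqP t1s|t1s].
  by move: ut1; rewrite t1s ltNge us.
suff : 0 < u s by rewrite ltNge us.
apply: hr => //; rewrite /ball /= distrC ger0_norm; last by rewrite subr_ge0 ltW.
by rewrite ltrBlDl.
Qed.

(** [st k] are the jump factors of the positive periodic solution [Nst];
    [up k] bound those of the curve [y] introduced below. *)
Variables (up st : nat -> R) (g Nst : R -> R).
Hypothesis st_gt0 : forall k, (1 <= k)%N -> 0 < st k.
Hypothesis st_le_up : forall k, (1 <= k)%N -> st k <= up k.
Hypothesis st_per : forall k, (1 <= k)%N -> st (k + p)%N = st k.
Hypothesis up_per : forall k, (1 <= k)%N -> up (k + p)%N = up k.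
Hypothesis up_prod : \prod_(1 <= k < p.+1) up k <= 1.
Hypothesis Nst_curve : impulsive_curve tau Nst (fun t => g t - a t * Nst t)
  (fun k => st k * Nst (tau k)).
Hypothesis Nst_gt0 : forall t : R, 0 < Nst t.
Hypothesis Nst_per : forall t : R, Nst (t + w) = Nst t.
Hypothesis g_ge0 : forall t : R, 0 < t -> 0 <= g t.

Let up_gt0 k : (1 <= k)%N -> 0 < up k.
Proof. by move=> k1; apply: lt_le_trans (st_le_up k1); exact: st_gt0. Qed.

Let Pup := \prod_(1 <= k < p.+1) up k.
Let Pst := \prod_(1 <= k < p.+1) st k.
Let e0 := expR (- Aw).
Let nu := rescaled up Nst.
Let mu := rescaled st Nst.
Let jump k := nu (tau k) * (1 - st k / up k).
(** [nu] with its jumps at the [tau k] added back. *)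
Let prim t := nu t + \sum_(1 <= k < (nimp t).+1) jump k.

Let Pup_gt0 : 0 < Pup. Proof. exact: prod_pos. Qed.
Let Pst_gt0 : 0 < Pst. Proof. exact: prod_pos. Qed.
Let e0_gt0 : 0 < e0. Proof. exact: expR_gt0. Qed.
Let e0_lt1 : e0 < 1. Proof. by rewrite expR_lt1 oppr_lt0. Qed.

Let nu_gt0 t : 0 < nu t.
Proof. by rewrite mulr_gt0 // divr_gt0 ?expR_gt0 // prod_before_gt0. Qed.

Let rescaled_per d t : 0 < t -> (forall k, (1 <= k)%N -> 0 < d k) ->
  (forall k, (1 <= k)%N -> d (k + p)%N = d k) ->
  rescaled d Nst t = \prod_(1 <= k < p.+1) d k * e0 * rescaled d Nst (t + w).
Proof.
move=> t0 d0 dp; rewrite /rescaled prod_before_per // A_per // Nst_per expRD /e0 expRN.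
by field; rewrite !gt_eqF ?expR_gt0 // ?prod_pos // prod_before_gt0.
Qed.

Let nu_per (t : R) : 0 < t -> nu (t + w) = (Pup * e0)^-1 * nu t.
Proof.
move=> t0; rewrite /nu [rescaled up Nst t]rescaled_per // mulKf //.
by rewrite gt_eqF // mulr_gt0.
Qed.

Lemma prim_curve : impulsive_curve tau prim (fun t => expR (A t) / prod_before up t * g t)
  (fun k => prim (tau k)).
Proof.
have Sc := impulsive_curve_step tau_incr nimpP
  (fun n => \sum_(1 <= k < n.+1) jump k).
apply: impulsive_curve_eq (impulsive_curveD (rescaled_curve up Nst_curve) Sc) => //.
  by move=> t; rewrite addr0 subrK.
move=> k k1; rewrite /prim (nimp_tau tau_incr nimpP) // prednK // [X in _ + X]big_nat_recr //=.
rewrite prod_tau // addrA addrAC; congr (_ + _).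
rewrite /jump /nu /rescaled; field.
by rewrite !gt_eqF ?up_gt0 // prod_before_gt0.
Qed.

Lemma mu_curve : impulsive_curve tau mu (fun t => expR (A t) / prod_before st t * g t)
  (fun k => mu (tau k)).
Proof.
apply: impulsive_curve_eq (rescaled_curve st Nst_curve) => //.
  by move=> t; rewrite subrK.
move=> k k1; rewrite prod_tau // /mu /rescaled; field.
by rewrite !gt_eqF ?st_gt0 // prod_before_gt0.
Qed.

Lemma jumpless_nondecreasing (f df : R -> R) s t :
  impulsive_curve tau f df (fun k => f (tau k)) ->
  (forall t : R, 0 < t -> 0 <= df t) -> 0 < s -> s <= t -> f s <= f t.
Proof.
move=> fc df0 s0 st'; have fc' := impulsive_curveZ (-1) fc.
rewrite -lerN2 -mulN1r -[X in _ <= X]mulN1r.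
apply: (impulsive_curve_nonincreasing nimpP fc') => //.
by move=> u /andP[su _] _; rewrite mulN1r oppr_le0 df0 // (lt_trans s0).
Qed.

Lemma prim_nondecreasing s t : 0 < s -> s <= t -> prim s <= prim t.
Proof.
apply: jumpless_nondecreasing prim_curve _ => u u0.
by rewrite mulr_ge0 ?g_ge0 // divr_ge0 ?expR_ge0 // ltW // prod_before_gt0.
Qed.

Lemma mu_nondecreasing s t : 0 < s -> s <= t -> mu s <= mu t.
Proof.
apply: jumpless_nondecreasing mu_curve _ => u u0.
by rewrite mulr_ge0 ?g_ge0 // divr_ge0 ?expR_ge0 // ltW // prod_before_gt0.
Qed.

(** [mu] is nondecreasing, hence bounded on a period, and [Nst] differs from it
    by factors taking finitely many values or bounded below. *)
Lemma Nst_bounded : (forall t : R, 0 < t -> 0 <= a t) ->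
  exists M : R, forall t : R, w <= t <= w + w -> Nst t <= M.
Proof.
move=> a0.
have A_nondecreasing s t : 0 < s -> s <= t -> A s <= A t.
  by apply: jumpless_nondecreasing a0; exact: impulsive_curve_derive.
pose S := \sum_(j < (nimp (w + w)).+1) \prod_(1 <= k < j.+1) st k.
exists (mu (w + w) * S / expR (A w)) => t /andP[wt tw].
have t0 : 0 < t by exact: lt_le_trans wt.
have p0 := prod_before_gt0 t st_gt0.
have -> : Nst t = mu t * prod_before st t / expR (A t).
  by rewrite /mu /rescaled; field; rewrite !gt_eqF ?expR_gt0.
have mu_ge0 s : 0 <= mu s.
  by rewrite mulr_ge0 ?divr_ge0 ?expR_ge0 // ltW // prod_before_gt0.
have S0 : prod_before st t <= S.
  have kt : (nimp t < (nimp (w + w)).+1)%N by rewrite ltnS (nimp_le nimpP).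
  rewrite /S (bigD1 (Ordinal kt)) //= lerDl sumr_ge0 // => j _.
  by apply/ltW/prod_pos.
apply: ler_pM.
- by rewrite mulr_ge0 // ltW.
- by rewrite invr_ge0 expR_ge0.
- by apply: ler_pM => //; [exact: ltW|exact: mu_nondecreasing].
- by rewrite lef_pV2 ?posrE ?expR_gt0 // ler_expR A_nondecreasing.
Qed.

Lemma prod_ratio_nonincreasing s t : s <= t ->
  prod_before st t / prod_before up t <= prod_before st s / prod_before up s.
Proof.
move=> st'; rewrite /prod_before -!prodf_div.
rewrite (big_cat_nat (n := (nimp s).+1)) //=; last first.
  by rewrite ltnS; exact: (nimp_le nimpP).
apply: ler_piMr; first by apply/ltW/prod_pos => // i i1; rewrite divr_gt0 ?up_gt0 ?st_gt0.
rewrite big_nat; apply: prodr_ile1 => i /andP[i1 _].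
have {}i1 : (1 <= i)%N by exact: leq_trans i1.
by rewrite divr_ge0 ?(ltW (st_gt0 _)) ?(ltW (up_gt0 _)) //= ler_pdivrMr ?mul1r ?st_le_up ?up_gt0.
Qed.

(** [nu] and its jumps are multiplied by the same constant over a period. *)
Lemma prim_quasi_periodic s t : 0 < s -> 0 < t ->
  prim t - prim s = Pup * e0 * (prim (t + w) - prim (s + w)).
Proof.
move=> s0 t0.
have jp k : (1 <= k)%N -> jump (k + p)%N = (Pup * e0)^-1 * jump k.
  move=> k1; rewrite /jump st_per // up_per // tau_per //.
  by rewrite nu_per ?tau_gt0 // -mulrA.
rewrite /prim !(sum_before_per _ jp) // !nu_per //.
by field; rewrite !gt_eqF.
Qed.

Let Pst_le1 : Pst <= 1.
Proof.
apply: le_trans up_prod; rewrite /Pst big_nat [leRHS]big_nat.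
by apply: ler_prod => i /andP[i1 _]; rewrite ltW ?st_gt0 ?st_le_up.
Qed.

(** The derivative of [prim] is that of [mu] times the ratio P_st / P_up, which is
    nonincreasing; so the increment of [prim] over [t - w, t] is at most the ratio
    at [t - w] times the increment of [mu].  Estimating the quotient P_up / P_st
    as a whole, rather than P_up and 1 / P_st separately, is what makes the
    constant as small as 1 / [Pst]. *)
Lemma prim_period t : w < t -> prim t - prim (t - w) <= (1 - e0 * Pst) / Pst * nu t.
Proof.
move=> wt; have t0 : 0 < t - w by rewrite subr_gt0.
pose c := prod_before st (t - w) / prod_before up (t - w).
have cnu : c * mu (t - w) = nu (t - w).
  rewrite /c /mu /nu /rescaled; field.
  by rewrite !gt_eqF // prod_before_gt0.
have cmu : c * mu t = Pup / Pst * nu t.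
  have pE d : (forall k, (1 <= k)%N -> d (k + p)%N = d k) -> prod_before d t =
      prod_before d (t - w) * \prod_(1 <= k < p.+1) d k.
    by move=> dp; rewrite -prod_before_per // subrK.
  rewrite /c /mu /nu /rescaled !pE // -/Pup -/Pst; field.
  by rewrite !gt_eqF // prod_before_gt0.
have nup : nu (t - w) = Pup * e0 * nu t.
  have := nu_per t0; rewrite subrK => ->; rewrite mulVKf //.
  by rewrite gt_eqF // mulr_gt0.
have hc := impulsive_curveD prim_curve (impulsive_curveZ (- c) mu_curve).
have h : prim t + - c * mu t <= prim (t - w) + - c * mu (t - w).
  apply: (impulsive_curve_nonincreasing nimpP hc t0) => //; first by rewrite gerBl ltW.
  move=> u /andP[tu ut] _; have u0 : 0 < u by exact: lt_trans tu.
  have -> : expR (A u) / prod_before up u * g u +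
      - c * (expR (A u) / prod_before st u * g u) =
      expR (A u) * g u / prod_before st u *
      (prod_before st u / prod_before up u - c).
    by field; rewrite !gt_eqF // prod_before_gt0.
  rewrite mulr_ge0_le0 ?subr_le0 ?(prod_ratio_nonincreasing (ltW tu)) //.
  by rewrite divr_ge0 ?mulr_ge0 ?expR_ge0 ?g_ge0 // ltW // prod_before_gt0.
have {}h : prim t - prim (t - w) <= Pup * ((1 - e0 * Pst) / Pst * nu t).
  rewrite !mulNr cmu cnu nup in h.
  have -> : Pup * ((1 - e0 * Pst) / Pst * nu t) =
    Pup / Pst * nu t - Pup * e0 * nu t by field; rewrite gt_eqF.
  by lra.
apply: le_trans h _; apply: ler_piMl; last exact: up_prod.
rewrite mulr_ge0 ?(ltW (nu_gt0 _)) // divr_ge0 ?(ltW Pst_gt0) // subr_ge0.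
by rewrite mulr_ile1 // ltW.
Qed.

(** The increments of [prim] over the periods preceding [t] decrease at least as
    fast as a geometric progression of ratio [e0]. *)
Lemma prim_window m t : w < t -> (m%:R : R) * w < t ->
  prim t - prim (t - m%:R * w) <=
  (1 - e0 ^+ m) / (1 - e0) * ((1 - e0 * Pst) / Pst) * nu t.
Proof.
move=> wt; have De0 : 0 < 1 - e0 by rewrite subr_gt0.
have Ht : 0 <= prim t - prim (t - w).
  by rewrite subr_ge0 prim_nondecreasing ?subr_gt0 // gerBl ltW.
suff h : (m%:R : R) * w < t ->
    (1 - e0) * (prim t - prim (t - m%:R * w)) <= (1 - e0 ^+ m) * (prim t - prim (t - w)).
  move=> /h {}h; rewrite -mulrA mulrAC ler_pdivlMr // mulrC.
  apply: le_trans h _; apply: ler_wpM2l; last exact: prim_period.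
  by rewrite subr_ge0 exprn_ile1 // ltW.
elim: m => [|m IH] mt; first by rewrite mul0r subr0 expr0 !subrr mul0r mulr0.
have mE : m.+1%:R * w = m%:R * w + w by rewrite -addn1 natrD mulrDl mul1r.
rewrite mE in mt *; have mt' : m%:R * w < t by apply: lt_trans mt; rewrite ltrDl.
have mt0 : 0 < t - (m%:R * w + w) by rewrite subr_gt0.
have h1 : prim (t - w) - prim (t - (m%:R * w + w)) =
    Pup * e0 * (prim t - prim (t - m%:R * w)).
  have := prim_quasi_periodic mt0 (_ : 0 < t - w).
  have -> : t - w + w = t by lra.
  have -> : t - (m%:R * w + w) + w = t - m%:R * w by lra.
  by apply; rewrite subr_gt0.
have h2 : Pup * e0 * (prim t - prim (t - m%:R * w)) <= e0 * (prim t - prim (t - m%:R * w)).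
  rewrite -mulrA; apply: ler_piMl => //; apply: mulr_ge0; first exact: ltW.
  rewrite subr_ge0; apply: prim_nondecreasing; first lra.
  by rewrite gerBl mulr_ge0 // ltW.
have {}IH := IH mt'.
have := ler_wpM2l (ltW De0) h2.
have := ler_wpM2l (ltW e0_gt0) IH.
rewrite exprS => h3 h4.
have -> : (1 - e0) * (prim t - prim (t - (m%:R * w + w))) =
  (1 - e0) * (prim t - prim (t - w)) + (1 - e0) * (Pup * e0 * (prim t - prim (t - m%:R * w))).
  by rewrite -h1; ring.
by lra.
Qed.

(** [nu] is bounded below on one period and gains a factor larger than 1 over
    each period. *)
Lemma rescaled_unbounded M : exists2 T, 0 < T & forall t, T <= t -> M <= nu t.
Proof.
pose c := mu w * (prod_before st (w + w) / prod_before up (w + w)).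
have mu_gt0 t : 0 < mu t by rewrite mulr_gt0 // divr_gt0 ?expR_gt0 // prod_before_gt0.
have c0 : 0 < c by rewrite mulr_gt0 // divr_gt0 // prod_before_gt0.
have nuc s : w <= s <= w + w -> c <= nu s.
  move=> /andP[ws sw]; have -> : nu s = mu s * (prod_before st s / prod_before up s).
    by rewrite /nu /mu /rescaled; field; rewrite !gt_eqF // prod_before_gt0.
  apply: ler_pM; [exact: ltW| |exact: mu_nondecreasing|exact: prod_ratio_nonincreasing].
  by rewrite divr_ge0 // ltW // prod_before_gt0.
pose l := (Pup * e0)^-1 - 1.
have l0 : 0 < l.
  rewrite subr_gt0 invf_gt1 ?mulr_gt0 //.
  by apply: le_lt_trans e0_lt1; apply: ler_piMl => //; exact: ltW.
have lE : (Pup * e0)^-1 = 1 + l by rewrite addrC subrK.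
clearbody c l.
have nuj s j : w <= s <= w + w -> c * (1 + j%:R * l) <= nu (s + j%:R * w).
  move=> sw; elim: j => [|j IH]; first by rewrite !mul0r !addr0 mulr1 nuc.
  have -> : s + j.+1%:R * w = s + j%:R * w + w by rewrite -addn1 natrD; lra.
  have s0 : 0 < s by apply: lt_le_trans w_gt0 _; case/andP: sw.
  rewrite nu_per; last by rewrite ltr_pwDl // mulr_ge0 // ltW.
  rewrite lE.
  apply: le_trans (ler_wpM2l _ IH); last lra.
  rewrite -addn1 natrD.
  have : 0 <= c * (j%:R * l * l) by rewrite !mulr_ge0 // ltW.
  by lra.
have [J hJ] : exists J : nat, M <= c * (1 + J%:R * l).
  exists (Num.bound (`|M| / (c * l))).
  have := archi_boundP (divr_ge0 (normr_ge0 M) (ltW (mulr_gt0 c0 l0))).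
  rewrite ltr_pdivrMr ?mulr_gt0 // => hM; apply: le_trans (ler_norm M) _.
  by apply/ltW/(lt_trans hM); rewrite -subr_gt0 (_ : _ - _ = c) //; ring.
exists (w + w + J%:R * w).
  by rewrite ltr_pwDl ?addr_gt0 // mulr_ge0 // ltW.
move=> t tJ; have [||j [s [sw tE]]] := @period_reduction R w t => //.
  by apply: le_trans tJ; rewrite -addrA lerDl addr_ge0 ?mulr_ge0 // ltW.
rewrite tE; apply: le_trans hJ _; apply: le_trans (nuj _ _ sw).
rewrite ler_pM2l // lerD2l ler_pM2r // ler_nat.
rewrite -(ler_nat R) -(ler_pM2r w_gt0).
by case/andP: sw; lra.
Qed.


Variables (y dy : R -> R) (yp : nat -> R).
Hypothesis y_curve : impulsive_curve tau y dy yp.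
Hypothesis yp_le : forall k, (1 <= k)%N -> 0 <= y (tau k) -> yp k <= up k * y (tau k).
Hypothesis yp_lt0 : forall k, (1 <= k)%N -> y (tau k) < 0 -> yp k < 0.

Let zeta := rescaled up y.

Lemma rescaled_growth C s t : 0 < s -> s <= t ->
  (forall u : R, s <= u < t -> 0 <= y u) ->
  (forall u : R, s < u < t -> off_tau tau u -> dy u + a u * y u <= C * g u) ->
  zeta t - zeta s <= C * (prim t - prim s).
Proof.
move=> s0 st' y0 dyg.
have hc := impulsive_curveD (rescaled_curve up y_curve) (impulsive_curveZ (- C) prim_curve).
suff : zeta t + - C * prim t <= zeta s + - C * prim s by lra.
apply: (impulsive_curve_nonincreasing nimpP hc s0) => //.
  move=> u /andP[su ut] ou; have u0 : 0 < u by exact: lt_trans su.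
  have -> : expR (A u) / prod_before up u * (dy u + a u * y u) +
      - C * (expR (A u) / prod_before up u * g u) =
      expR (A u) / prod_before up u * (dy u + a u * y u - C * g u).
    by ring.
  rewrite mulr_ge0_le0 ?subr_le0 ?dyg ?su //.
  by rewrite divr_ge0 ?expR_ge0 // ltW // prod_before_gt0.
move=> k k1 sk; rewrite lerD2r prod_tau // /zeta /rescaled.
have pu0 := prod_before_gt0 (tau k) up_gt0.
have -> : expR (A (tau k)) / (prod_before up (tau k) * up k) * yp k =
    expR (A (tau k)) / prod_before up (tau k) * (yp k / up k).
  by field; rewrite !gt_eqF ?up_gt0.
apply: ler_wpM2l; first by rewrite divr_ge0 ?expR_ge0 // ltW.
by rewrite ler_pdivrMr ?up_gt0 // mulrC yp_le // y0.
Qed.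

(** An impulse keeps a negative value negative, so [y] can become positive only
    by passing through an actual zero. *)
Lemma last_zero T t : 0 < T -> T <= t -> 0 < y t ->
  (forall u : R, T <= u <= t -> 0 < y u) \/
  exists t0 : R, [/\ T <= t0, t0 < t, y t0 = 0 &
                 forall u : R, t0 < u <= t -> 0 < y u].
Proof.
move=> T0 Tt yt; have [yl yr _ yj] := y_curve.
pose S := [set u : R | T <= u <= t /\ y u <= 0].
have [[s Ss]|S0] := pselect (S !=set0); last first.
  left=> u Tut; rewrite ltNge; apply/negP => yu; apply: S0.
  by exists u.
right; have S_sup : has_sup S.
  by split; [exists s|exists t => u [/andP[]]].
pose t0 := sup S.
have Tt0 : T <= t0.
  by case: (Ss) => /andP[Ts _] _; apply: le_trans Ts _; exact: (ub_le_sup S_sup.2).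
have t0t : t0 <= t by apply: ge_sup => [|v [/andP[]]//]; exists s.
have t00 : 0 < t0 by exact: lt_le_trans Tt0.
have ypos u : t0 < u <= t -> 0 < y u.
  move=> /andP[t0u ut]; rewrite ltNge; apply/negP => yu.
  suff /(ub_le_sup S_sup.2) : S u by rewrite leNgt t0u.
  by split => //; rewrite ut andbT (le_trans Tt0) // ltW.
have yt0 : y t0 <= 0.
  rewrite leNgt; apply/negP => yt0.
  have hc : \forall u \near t0^'-, 0 < y u by exact: (@cvgr_gt _ _ _ _ _ _ (yl _ t00)).
  move: hc; rewrite near_withinE => /nbhs_ballP[e /= e0' he].
  have [v [Tvt yv] ev] := sup_adherent e0' S_sup.
  move: (yv); rewrite leNgt => /negP; apply.
  have := ub_le_sup S_sup.2 (conj Tvt yv); rewrite -/t0 le_eqVlt => /orP[/eqP ->//|vt0].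
  apply: he => //; rewrite /ball /= ger0_norm; last by rewrite subr_ge0 ltW.
  by rewrite ltrBlDr -ltrBlDl.
have {}t0t : t0 < t.
  by rewrite lt_neqAle t0t andbT; apply: contraTneq yt0 => ->; rewrite -ltNge.
have near_pos : \forall u \near t0^'+, 0 <= y u.
  near=> u; apply/ltW/ypos/andP; split; near: u; first exact: nbhs_right_gt.
  exact: nbhs_right_le.
exists t0; split=> //; apply/le_anti; rewrite yt0 /=.
have [[k k1 t0k]|h] := pselect (exists2 k, (1 <= k)%N & t0 = tau k).
  rewrite leNgt; apply/negP; rewrite t0k => /(yp_lt0 k1).
  rewrite ltNge => /negP; apply; rewrite t0k in near_pos.
  exact: cvgr_to_ge (yj k k1) near_pos.
apply: cvgr_to_ge (yr _ t00 _) near_pos => k k1 t0k; apply: h.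
by exists k.
Unshelve. all: by end_near. Qed.

(** This makes the increment of [prim] over [s, s + D] at most the one over
    [t - D, t] even when [t] lies beyond [s + D]: the part of the window lost on the
    left is recovered, enlarged, on the right. *)
Lemma prim_increment_shift (j : nat) (u v : R) : 0 < u -> u <= v ->
  prim v - prim u <= prim (v + j%:R * w) - prim (u + j%:R * w).
Proof.
move=> u0 uv; elim: j => [|j IH]; first by rewrite mul0r !addr0.
apply: le_trans IH _.
have jw : 0 <= (j%:R : R) * w by rewrite mulr_ge0 // ltW.
have uj : 0 < u + j%:R * w by rewrite ltr_pwDl.
have vj : 0 < v + j%:R * w by rewrite ltr_pwDl // (lt_le_trans u0).
have -> : v + j.+1%:R * w = v + j%:R * w + w by rewrite -natr1 mulrDl mul1r addrA.
have -> : u + j.+1%:R * w = u + j%:R * w + w by rewrite -natr1 mulrDl mul1r addrA.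
rewrite (prim_quasi_periodic uj vj); apply: ler_piMl.
  rewrite subr_ge0; apply: prim_nondecreasing; first exact: addr_gt0.
  by rewrite !lerD2r.
by rewrite mulr_ile1 // ltW.
Qed.

(** Negative feedback with delay: a positive excursion of [y] is fed only during
    the delay following its starting zero, so it is bounded by what the linear
    equation can accumulate over one delay. *)
Lemma one_sided_bound (m : nat) (C T eps : R) :
  0 <= C -> 0 < T -> 0 < eps ->
  (forall t : R, T < t -> off_tau tau t -> dy t + a t * y t <= C * g t) ->
  (forall t : R, T < t -> off_tau tau t ->
     (forall s : R, t - m%:R * w <= s < t -> 0 < y s) -> dy t + a t * y t <= 0) ->
  exists T' : R, forall t : R, T' < t ->
    y t <= (C * ((1 - e0 ^+ m) / (1 - e0) * ((1 - e0 * Pst) / Pst)) + eps) * Nst t.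
Proof.
have w0 := w_gt0; move=> C0 T0 eps0 dyC dy0; set Q := _ / _ * _.
have shift u v := @prim_increment_shift m u v.
have [D DE] : exists D : R, D = m%:R * w by eexists.
rewrite -DE in shift dy0.
have window t : 0 < t - w -> 0 < t - D -> prim t - prim (t - D) <=
    (1 - e0 ^+ m) / (1 - e0) * ((1 - e0 * Pst) / Pst) * nu t.
  by rewrite !subr_gt0 DE; exact: prim_window.
have D0 : 0 <= D by rewrite DE mulr_ge0 // ltW.
pose T1 := T + D.
have TT1 : T <= T1 by rewrite lerDl.
have [T2 T20 nuT2] := rescaled_unbounded (zeta T1 / eps).
exists (Num.max T2 (T1 + w)) => t; rewrite gt_max => /andP[T2t T1t].
have Q0 : 0 <= Q.
  rewrite mulr_ge0 // divr_ge0 ?subr_ge0 ?(ltW Pst_gt0) ?(ltW e0_lt1) //.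
    by rewrite exprn_ile1 // ltW.
  by rewrite mulr_ile1 // ltW.
have {}T1t : 0 < t - (T + D + w) by rewrite subr_gt0.
have [yt|yt] := leP (y t) 0.
  apply: le_trans yt _; apply: mulr_ge0; last exact: ltW.
  exact: addr_ge0 (mulr_ge0 C0 Q0) (ltW eps0).
have t0 : 0 < t by lra.
have Et0 : 0 < expR (A t) / prod_before up t by rewrite divr_gt0 ?expR_gt0 // prod_before_gt0.
suff : zeta t <= (C * Q + eps) * nu t.
  by rewrite /zeta /nu /rescaled mulrCA ler_pM2l.
have {}nuT2 : zeta T1 <= eps * nu t.
  by rewrite -ler_pdivrMl // mulrC nuT2 // ltW.
have Hw : prim t - prim (t - D) <= Q * nu t.
  by apply: window; lra.
have Tt : T <= t by lra.
have [y0|[s [Ts st' ys y0]]] := last_zero T0 Tt yt.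
  have Tt1 : T1 <= t by rewrite /T1; lra.
  have h : zeta t - zeta T1 <= 0 * (prim t - prim T1).
    apply: rescaled_growth => //; first exact: lt_le_trans TT1.
      by move=> u /andP[T1u ut]; rewrite ltW // y0 // (ltW ut) (le_trans TT1).
    move=> u /andP[T1u ut] ou; rewrite mul0r; apply: dy0 => //.
      exact: le_lt_trans T1u.
    move=> v /andP[uv vu]; apply: y0; rewrite (ltW (lt_trans vu ut)) andbT.
    by apply: le_trans uv; rewrite /T1 in T1u; lra.
  have := mulr_ge0 (mulr_ge0 C0 Q0) (ltW (nu_gt0 t)); lra.
have s0 : 0 < s by exact: lt_le_trans Ts.
have zs : zeta s = 0 by rewrite /zeta /rescaled ys mulr0.
suff h : zeta t <= C * (prim t - prim (t - D)).
  apply: le_trans h _; rewrite mulrDl -mulrA.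
  by apply: le_trans (ler_wpM2l C0 Hw) _; rewrite lerDl mulr_ge0 // ltW.
have grow r : s <= r -> r <= t -> zeta r <= C * (prim r - prim s).
  move=> sr rt; have := @rescaled_growth C s r s0 sr; rewrite zs subr0; apply.
    move=> u /andP[]; rewrite le_eqVlt => /orP[/eqP <-|su ur]; first by rewrite ys.
    by apply/ltW/y0; rewrite su (ltW (lt_le_trans ur rt)).
  by move=> u /andP[su ur]; apply: dyC; exact: le_lt_trans su.
have [ts|ts] := leP t (s + D).
  apply: le_trans (grow t (ltW st') (lexx _)) _; apply: ler_wpM2l => //.
  by rewrite lerD2l lerN2; apply: prim_nondecreasing; lra.
have h : zeta t - zeta (s + D) <= 0 * (prim t - prim (s + D)).
  apply: rescaled_growth => //; [lra|lra| |].
    move=> u /andP[su ut]; have [us|us] := eqVneq u s; first by rewrite us ys.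
    apply/ltW/y0; rewrite (ltW ut) andbT lt_neqAle eq_sym us /=; lra.
  move=> u /andP[su ut] ou; rewrite mul0r; apply: dy0 => //; first lra.
  move=> v /andP[uv vu]; apply: y0; lra.
have h1 : zeta (s + D) <= C * (prim (s + D) - prim s).
  by apply: grow; lra.
suff h2 : prim (s + D) - prim s <= prim t - prim (t - D).
  by have := ler_wpM2l C0 h2; lra.
suff : prim (t - D) - prim s <= prim t - prim (s + D) by lra.
have := shift s (t - D) s0 (_ : s <= t - D); rewrite subrK; apply; lra.
Qed.

End linear_comparison.

(** * Auxiliary facts on periodic functions, counting and contraction *)

(** Here A(t) is the integral of [a] from -1 to t: starting at -1 makes 0 an
    interior point, so that the increment over a period, constant in t, can be
    evaluated at t = 0. *)
Lemma periodic_antiderivative (R : realType) (a : R -> R) (w : R) :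
  continuous a -> 0 < w -> periodic a w ->
  exists A : R -> R, [/\ forall t : R, 0 < t -> is_derive t (1 : R) A (a t),
    forall t : R, 0 < t -> A (t + w) = A t + int_period w a
    & (forall t, 0 < a t) -> 0 < int_period w a].
Proof.
move=> ac w0 ap.
pose A (t : R) := \int[lebesgue_measure]_(u in `[-1, t]) a u.
have integ (x y : R) : lebesgue_measure.-integrable `[x, y] (EFin \o a).
  apply: continuous_compact_integrable; first exact: segment_compact.
  exact: continuous_subspaceT.
have dA (t : R) : -1 < t -> is_derive t (1 : R) A (a t).
  move=> t1; have tt1 : t < t + 1 by rewrite ltrDl.
  have [dA Aa] := continuous_FTC1_closed tt1 (integ _ _) t1 (ac t).
  by apply: DeriveDef => //; rewrite -Aa derive1E.
have cA (s t : R) : -1 < s -> {within `[s, t], continuous A}.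
  move=> s1; apply: derivable_within_continuous => u; rewrite in_itv /= => /andP[su _].
  by have [] := dA u (lt_le_trans s1 su).
have Aw : A w - A 0 = int_period w a.
  have := @Rintegral_itvB _ _ _ _ 0 (integ (-1) w).
  rewrite !bnd_simp => hB; rewrite /A hB; [|lra|exact: ltW].
  rewrite Rintegral_itv_obnd_cbnd //.
  by apply: integrableS (integ 0 w) => //; apply: subset_itvr; rewrite bnd_simp.
exists A; split.
- by move=> t t0; apply: dA; lra.
- move=> t t0; pose d s := A (s + w) - A s.
  have dd (s : R) : -1 < s -> is_derive s (1 : R) d 0.
    move=> s1; rewrite -[0](subrr (a s)) -{1}[a s]ap.
    have dw : is_derive s (1 : R) (fun u => u + w) (1 + 0) by exact: is_deriveD.
    have dA' : is_derive (s + w) (1 : R) A (a (s + w)) by apply: dA; lra.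
    have : is_derive s (1 : R) (A \o (fun u => u + w)) (a (s + w) * (1 + 0)).
      exact: (@is_derive1_comp _ _ (fun u => u + w)).
    by rewrite addr0 mulr1 => h; apply: is_deriveB; exact: dA.
  have [||c _] := @MVT R d (fun=> 0) 0 t t0.
  + by move=> s; rewrite in_itv /= => /andP[s0 _]; apply: dd; lra.
  + apply: derivable_within_continuous => u; rewrite in_itv /= => /andP[u0 _].
    by have [] : is_derive u (1:R) d 0 by apply: dd; lra.
  by rewrite mul0r /d add0r Aw; lra.
- move=> a0; have [||c _] := @MVT R A a 0 w w0.
  + by move=> s; rewrite in_itv /= => /andP[s0 _]; apply: dA; lra.
  + by apply: cA; lra.
  by rewrite Aw subr0 => ->; rewrite mulr_gt0.
Qed.

Lemma counting_function (R : realType) (tau : nat -> R) :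
  (forall k, (1 <= k)%N -> tau k < tau k.+1) -> tau k @[k --> \oo] --> +oo ->
  exists nimp : R -> nat,
    forall (t : R) k, (1 <= k)%N -> (tau k < t) = (k <= nimp t)%N.
Proof.
move=> tau_incr tau_oo.
have tau_le j k : (1 <= j)%N -> (j <= k)%N -> tau j <= tau k.
  move=> j1; elim: k => [|k IH]; first by rewrite leqNgt j1.
  rewrite leq_eqVlt => /orP[/eqP ->//|]; rewrite ltnS => jk.
  by apply: le_trans (IH jk) (ltW (tau_incr _ _)); exact: leq_trans jk.
have ex t : exists k, t <= tau k.+1.
  have /cvgryPge/(_ t) [N _ hN] := tau_oo; exists N; apply: hN => /=.
  exact: leqnSn.
exists (fun t => ex_minn (ex t)) => t k k1; case: ex_minnP => n tn nmin.
apply/idP/idP => [kt|kn].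
  rewrite leqNgt; apply: contraTN kt => nk; rewrite -leNgt.
  exact: le_trans tn (tau_le _ _ _ _).
rewrite ltNge; apply: contraTN kn => tk; rewrite -ltnNge.
by case: k k1 tk => // k _ tk; rewrite ltnS; exact: nmin.
Qed.

Lemma counting_period (R : realType) (tau : nat -> R) (nimp : R -> nat) (w : R)
    (p : nat) :
  (forall (t : R) k, (1 <= k)%N -> (tau k < t) = (k <= nimp t)%N) ->
  (forall k, (1 <= k)%N -> tau (k + p)%N = tau k + w) ->
  (forall k, (1 <= k <= p)%N -> tau k <= w) ->
  forall t : R, 0 < t -> nimp (t + w) = (nimp t + p)%N.
Proof.
move=> nimpP tau_per tau_first t t0.
have iff k : (1 <= k)%N -> (k <= nimp (t + w)%R)%N = (k <= nimp t + p)%N.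
  move=> k1; rewrite -nimpP //; have [kp|pk] := leqP k p.
    have kw : tau k <= w by rewrite tau_first // k1.
    by rewrite (leq_trans kp (leq_addl _ _)); apply/idP; lra.
  have k1' : (1 <= k - p)%N by rewrite subn_gt0.
  by rewrite -(subnK (ltnW pk)) tau_per // ltrD2r nimpP // leq_add2r.
apply/eqP; rewrite eqn_leq; apply/andP; split.
  by case E : (nimp (t + w)%R) => [//|k]; rewrite -E -iff ?E.
by case E : (nimp t + p)%N => [//|k]; rewrite -E iff ?E.
Qed.

(** Convexity of exp between 0 and s, from 1 + z <= exp z at two points. *)
Lemma expR_chord (R : realType) (v s : R) : 0 <= v <= 1 ->
  expR (v * s) - 1 <= v * (expR s - 1).
Proof.
move=> /andP[v0 v1]; set X := expR (v * s).
have X0 : 0 <= X by exact: expR_ge0.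
have h1 : X * (1 + (1 - v) * s) <= expR s.
  have -> : expR s = X * expR ((1 - v) * s) by rewrite -expRD; congr expR; ring.
  by apply: ler_wpM2l => //; exact: expR_ge1Dx.
have h2 : X * (1 - v * s) <= 1.
  have X1 : X * expR (- (v * s)) = 1 by rewrite -expRD subrr expR0.
  by rewrite -[leRHS]X1; apply: ler_wpM2l => //; exact: expR_ge1Dx.
have v1' : 0 <= 1 - v by rewrite subr_ge0.
have := ler_wpM2l v0 h1; have := ler_wpM2l v1' h2; nra.
Qed.

(** If - x <= v Y eventually, the two hypotheses give
    - x <= (c1 c2 v + small) Y eventually; the small term is chosen so that the new
    constant is r v for a fixed r strictly between c1 c2 and 1. *)
Lemma alternating_contraction (R : realType) (x Y : R -> R) (c1 c2 : R) :
  (forall t, 0 < Y t) -> 0 <= c1 -> 0 <= c2 -> c1 * c2 < 1 ->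
  (forall v T, 0 <= v <= 1 -> (forall t : R, T < t -> - x t <= v * Y t) ->
     forall eps, 0 < eps -> exists T', forall t : R, T' < t -> x t <= (c1 * v + eps) * Y t) ->
  (forall u T, 0 <= u -> (forall t : R, T < t -> x t <= u * Y t) ->
     forall eps, 0 < eps -> exists T', forall t : R, T' < t -> - x t <= (c2 * u + eps) * Y t) ->
  (exists T, forall t : R, T < t -> - x t <= Y t) ->
  forall eps, 0 < eps -> exists T', forall t : R, T' < t -> `|x t| <= eps * Y t.
Proof.
move=> Y0 c10 c20 c12 h1 h2 [T0 x0].
pose r := (1 + c1 * c2) / 2.
have r0 : 0 < r by have := mulr_ge0 c10 c20; rewrite /r; lra.
have r1 : r < 1 by rewrite /r; lra.
have rc : c1 * c2 < r by rewrite /r; lra.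
clearbody r.
have iter n : exists T, forall t, T < t -> - x t <= r ^+ n * Y t.
  elim: n => [|n [T hT]]; first by exists T0 => t /x0; rewrite expr0 mul1r.
  pose v := r ^+ n; have v0 : 0 < v by exact: exprn_gt0.
  have v1 : v <= 1 by rewrite exprn_ile1 // ltW.
  pose e := (r - c1 * c2) * v / (1 + c2).
  have e0 : 0 < e.
    apply: divr_gt0; last by rewrite ltr_pwDl.
    by apply: mulr_gt0; rewrite ?subr_gt0.
  have v01 : 0 <= v <= 1 by rewrite ltW.
  have [T1 hT1] := h1 v T v01 hT e e0.
  have u0 : 0 <= c1 * v + e := addr_ge0 (mulr_ge0 c10 (ltW v0)) (ltW e0).
  have [T2 hT2] := h2 _ T1 u0 hT1 e e0.
  exists T2 => t /hT2; suff -> : c2 * (c1 * v + e) + e = r ^+ n.+1 by [].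
  rewrite exprS -/v /e; field; rewrite gt_eqF //; lra.
move=> eps eps0.
pose d := Num.min 1 (eps / (2 * (1 + c1))).
have c1' : 0 < 1 + c1 by rewrite ltr_pwDl.
have d0 : 0 < d by rewrite lt_min ltr01 divr_gt0 // mulr_gt0.
have [n rn] : exists n, r ^+ n < d.
  have : r ^+ n @[n --> \oo] --> 0.
    by apply: cvg_expr; rewrite gtr0_norm.
  move=> /cvgr_lt/(_ _ d0) [N _ hN]; exists N; apply: hN => /=; exact: leqnn.
have {rn}[T hT] : exists T, forall t, T < t -> - x t <= d * Y t.
  have [T hT] := iter n; exists T => t /hT {}hT; apply: le_trans hT _.
  by rewrite ler_pM2r // ltW.
have d01 : 0 <= d <= 1 by rewrite (ltW d0) ge_min lexx.
have deps : 2 * (1 + c1) * d <= eps.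
  by rewrite mulrC -ler_pdivlMr ?mulr_gt0 // ge_min lexx orbT.
have c1d : 0 <= c1 * d by rewrite mulr_ge0 // ltW.
have [T1 hT1] := h1 d T d01 hT d d0.
exists (Num.max T T1) => t; rewrite gt_max => /andP[/hT {}hT /hT1 {}hT1].
rewrite ler_norml lerNl; apply/andP; split.
  by apply: le_trans hT _; rewrite ler_pM2r //; lra.
by apply: le_trans hT1 _; rewrite ler_pM2r //; lra.
Qed.

Lemma le_sup_period (R : realType) (w : R) (f : R -> R) (M : R) : 0 < w ->
  (forall t, f (t + w) = f t) -> (forall t, w <= t <= w + w -> f t <= M) ->
  forall t, 0 <= t -> f t <= sup_period w f.
Proof.
move=> w0 fw fM t t0.
have [||j [s [/andP[ws sw] tE]]] := @period_reduction R w (t + w) => //; first by lra.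
have fj n u : f (u + n%:R * w) = f u.
  elim: n => [|n IH]; first by rewrite mul0r addr0.
  by rewrite -natr1 mulrDl mul1r addrA fw IH.
have -> : f t = f (s - w) by rewrite -fw tE fj -[in LHS](subrK w s) fw.
apply: ub_le_sup; last by exists (s - w) => //=; rewrite in_itv /=; lra.
exists M => _ [u /= + <-]; rewrite in_itv /= => /andP[u0 uw].
by rewrite -fw; apply: fM; lra.
Qed.

Lemma continuous_bounded_period (R : realType) (w : R) (f : R -> R) :
  0 < w -> continuous f -> exists M, forall t, w <= t <= w + w -> f t <= M.
Proof.
move=> w0 fc; have [||c _ hc] := @EVT_max R f w (w + w); first by lra.
  exact: continuous_subspaceT.
by exists (f c) => t tw; apply: hc; rewrite in_itv.
Qed.

(** * The constants of the smallness condition *)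

(** Bernoulli inequality, after replacing the positive [c k] by 0. *)
Lemma prod1D_ge (R : realType) (c : nat -> R) (n : nat) :
  (forall k, (1 <= k <= n)%N -> -1 < c k) ->
  1 + \sum_(1 <= k < n.+1) Num.min (c k) 0 <= \prod_(1 <= k < n.+1) (1 + c k).
Proof.
move=> c1; pose d k := Num.min (c k) 0.
have d0 k : d k <= 0 by rewrite ge_min lexx orbT.
have d1 k : (1 <= k <= n)%N -> 0 <= 1 + d k.
  by move=> /c1 ck; rewrite -lerBlDl sub0r le_min ltW //= lerN10.
have h j : (j <= n)%N -> 1 + \sum_(1 <= k < j.+1) d k <= \prod_(1 <= k < j.+1) (1 + d k) <= 1.
  elim: j => [|j IH] jn; first by rewrite !big_nil addr0 lexx.
  have /andP[h1 h2] := IH (ltnW jn).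
  rewrite !(@big_nat_recr _ _ _ j.+1) //=.
  have P0 : 0 <= \prod_(1 <= k < j.+1) (1 + d k).
    rewrite big_nat; apply: prodr_ge0 => k /andP[k1 kj]; apply: d1.
    by rewrite k1 (leq_trans _ (ltnW jn)).
  have := d0 j.+1; have := d1 j.+1; rewrite jn => /(_ isT) h3 h4.
  set P := \prod_(_ <= _ < _) _ in h1 h2 P0 *; set S := \sum_(_ <= _ < _) _ in h1 *.
  have : 0 <= (1 - P) * - d j.+1 by rewrite mulr_ge0 ?subr_ge0 ?oppr_ge0.
  have : 0 <= P * - d j.+1 by rewrite mulr_ge0 ?oppr_ge0.
  move=> h5 h6; apply/andP; split; lra.
have /andP[h1 _] := h n (leqnn n); apply: le_trans h1 _.
rewrite big_nat [leRHS]big_nat; apply: ler_prod => k kn.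
by rewrite d1 //= lerD2l ge_min lexx.
Qed.

(** A full period of factors occurs in the maximum, for l = j = p. *)
Lemma Bmax_ge (R : realType) (p : nat) (bk : nat -> R) : (0 < p)%N ->
  (forall k, (1 <= k)%N -> bk (k + p)%N = bk k) ->
  (\prod_(1 <= k < p.+1) (1 + bk k))^-1 <= Bmax p bk.
Proof.
move=> p0 bp; have pr : p \in index_iota 1 p.+1 by rewrite mem_index_iota p0 ltnSn.
have -> : (\prod_(1 <= k < p.+1) (1 + bk k))^-1 =
    \prod_(1 <= k < p.+1) (1 + bk (p + k)%N)^-1.
  rewrite -prodfV big_nat [RHS]big_nat; apply: eq_bigr => k /andP[k1 _].
  by rewrite addnC bp.
pose F l j := \prod_(1 <= k < j.+1) (1 + bk (l + k)%N)^-1.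
apply: (@le_trans _ _ (\big[Num.max/0]_(1 <= j < p.+1) F p j)).
  exact: (le_bigmax_seq 0 p xpredT (F p) pr isT).
exact: (le_bigmax_seq 0 p xpredT
  (fun l => \big[Num.max/0]_(1 <= j < p.+1) F l j) pr isT).
Qed.

(** [P] is the product of the jump factors of the periodic solution over a
    period and [S] the sum of the negative parts, so that 1 - e0 P <= 1 - e0 - S
    by the Bernoulli inequality; as B >= 1, a single factor [B] in the estimate of
    Q is enough to stay below B ^ m. *)
Lemma loop_gain_lt1 (R : realType) (m : nat) (q1 q2 e0 P B S Q : R) :
  (0 < m)%N -> 0 <= q1 -> 0 <= q2 -> 0 < e0 -> e0 < 1 -> 0 < P -> P <= 1 ->
  P^-1 <= B -> S <= 0 -> 1 + S <= P ->
  B ^+ m * Num.sqrt (q2 * q1) * (1 - e0 ^+ m) * (1 - (1 - e0)^-1 * S) < 1 ->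
  Q = (1 - e0 ^+ m) / (1 - e0) * ((1 - e0 * P) / P) ->
  q1 * Q * (q2 * Q) < 1.
Proof.
move=> m0 q10 q20 e00 e01 P0 P1 PB S0 SP small QE.
have B1 : 1 <= B by apply: le_trans _ PB; rewrite invf_ge1.
have D0 : 0 < 1 - e0 by rewrite subr_gt0.
have Em : 0 <= 1 - e0 ^+ m by rewrite subr_ge0 exprn_ile1 // ltW.
have eP : 0 <= 1 - e0 * P by rewrite subr_ge0 mulr_ile1 // ltW.
pose K := B ^+ m * (1 - e0 ^+ m) * (1 - (1 - e0)^-1 * S).
have Q0 : 0 <= Q by rewrite QE mulr_ge0 // divr_ge0 // ltW.
have QK : Q <= K.
  rewrite QE; have -> : K = (1 - e0 ^+ m) / (1 - e0) * ((1 - e0 - S) * B ^+ m).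
    by rewrite /K; field; rewrite gt_eqF.
  apply: ler_wpM2l; first by rewrite divr_ge0 // ltW.
  apply: ler_pM => //; first by rewrite invr_ge0 ltW.
    have := ler_wpM2l (ltW e00) SP; have : 0 <= (1 - e0) * - S by rewrite mulr_ge0 ?oppr_ge0 // ltW.
    by lra.
  by apply: le_trans PB _; rewrite ler_eXnr.
have q0 : 0 <= q2 * q1 by rewrite mulr_ge0.
have -> : q1 * Q * (q2 * Q) = (Num.sqrt (q2 * q1) * Q) ^+ 2.
  by rewrite exprMn sqr_sqrtr //; ring.
rewrite expr_lt1 //; last by rewrite mulr_ge0 // sqrtr_ge0.
apply: le_lt_trans small.
have -> : B ^+ m * Num.sqrt (q2 * q1) * (1 - e0 ^+ m) * (1 - (1 - e0)^-1 * S) =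
  Num.sqrt (q2 * q1) * K by rewrite /K; ring.
by rewrite ler_wpM2l // sqrtr_ge0.
Qed.


(** * The attractivity theorem *)

Lemma solution_curve (R : realType) (w : R) (n : nat) (m : 'I_n -> nat)
    (a : R -> R) (b beta : 'I_n -> R -> R) (tau : nat -> R) (I : nat -> R -> R)
    (N : R -> R) : (forall k, (1 <= k)%N -> 0 < tau k) ->
  is_solution w m a b beta tau I N ->
  impulsive_curve tau N
    (fun t => \sum_(i < n) b i t * expR (- beta i t * N (t - (m i)%:R * w))
              - a t * N t)
    (fun k => N (tau k) + I k (N (tau k))).
Proof.
move=> tau_gt0 [Nl Nc Nd Nj]; split=> // [t t0 ot|t t0 ot|k k1].
- by apply: cvg_at_right_filter; exact: Nc.
- by have [dN hdN <-] := Nd t t0 ot; rewrite addrK.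
- have h : N (tau k) + (N s - N (tau k)) @[s --> (tau k)^'+] --> N (tau k) + I k (N (tau k)).
    by apply: cvgD; [exact: cvg_cst|exact: Nj].
  by apply: cvg_trans h; apply: near_eq_cvg; near=> s; rewrite addrC subrK.
Unshelve. all: by end_near. Qed.

(** Induction along an arithmetic progression, to extend what is known for one
    period of impulses to all of them. *)
Lemma periodic_step (Q : nat -> Prop) (p : nat) : (0 < p)%N ->
  (forall k, (1 <= k <= p)%N -> Q k) ->
  (forall k, (1 <= k)%N -> Q k -> Q (k + p)%N) ->
  forall k, (1 <= k)%N -> Q k.
Proof.
move=> p0 Q1 Qp; elim/ltn_ind => k IH k1; have [kp|pk] := leqP k p.
  by apply: Q1; rewrite k1.
rewrite -(subnK (ltnW pk)); apply: Qp; first by rewrite subn_gt0.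
by apply: IH; rewrite ?subn_gt0 // -subn_gt0 subKn // ltnW.
Qed.

Theorem theorem3p3 (R : realType) (w : R) (n p : nat) (m : 'I_n -> nat)
  (a : R -> R) (b beta : 'I_n -> R -> R)
  (tau : nat -> R) (I : nat -> R -> R) (ak bk : nat -> R) (Nstar : R -> R)
  (w_gt0 : 0 < w) (n_gt0 : (0 < n)%N) (p_gt0 : (0 < p)%N)
  (m_gt0 : forall i, (0 < m i)%N)
  (a_cont : continuous a) (a_gt0 : forall t, 0 < a t) (a_per : periodic a w)
  (b_cont : forall i, continuous (b i)) (b_gt0 : forall i t, 0 < b i t)
  (b_per : forall i, periodic (b i) w)
  (beta_cont : forall i, continuous (beta i))
  (beta_gt0 : forall i t, 0 < beta i t)
  (beta_per : forall i, periodic (beta i) w)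
  (tau1_gt0 : 0 < tau 1%N)
  (tau_incr : forall k, (1 <= k)%N -> tau k < tau k.+1)
  (tau_oo : tau k @[k --> \oo] --> +oo)
  (I_cont : forall k, (1 <= k)%N -> {within `[0, +oo[, continuous (I k)})
  (I_pos : forall k, (1 <= k)%N -> forall u, 0 < u -> 0 < u + I k u)
  (tau_per : forall k, (1 <= k)%N -> tau (k + p)%N = tau k + w)
  (I_per : forall k, (1 <= k)%N -> forall u, 0 < u -> I (k + p)%N u = I k u)
  (tau_p : forall k, (1 <= k)%N -> (tau k \in `[0, w]) = (k <= p)%N)
  (ak_per : forall k, (1 <= k)%N -> ak (k + p)%N = ak k)
  (bk_per : forall k, (1 <= k)%N -> bk (k + p)%N = bk k)
  (bk_gtN1 : forall k, (1 <= k <= p)%N -> -1 < bk k)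
  (I_lip : forall k, (1 <= k <= p)%N -> forall x y, 0 <= x -> 0 <= y -> x <> y ->
     bk k <= (I k x - I k y) / (x - y) <= ak k)
  (ak_prod : \prod_(1 <= k < p.+1) (1 + ak k) <= 1)
  (I0 : forall k, (1 <= k)%N -> I k 0 = 0)
  (Nstar_sol : is_solution w m a b beta tau I Nstar)
  (Nstar_gt0 : forall t, 0 < Nstar t)
  (Nstar_per : periodic Nstar w)
  (small :
     Bmax p bk ^+ mbar m *
     Num.sqrt (beta_bar w beta * sup_period w Nstar *
               (expR (betaN_bar w beta Nstar) - 1)) *
     (1 - expR (- ((mbar m)%:R * int_period w a))) *
     (1 - (1 - expR (- int_period w a))^-1 *
          \sum_(1 <= k < p.+1) Num.min (bk k) 0) < 1) :
  forall N : R -> R, is_positive_solution w m a b beta tau I N ->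
    N t - Nstar t @[t --> +oo] --> 0.
Proof.
move=> N [N_sol N0 [phi [_ _ phi0 Nphi]]].
have tau_gt0 k : (1 <= k)%N -> 0 < tau k.
  by elim: k => // -[|k] IH _ //; exact: lt_trans (IH isT) (tau_incr k.+1 isT).
have [nimp nimpP] := counting_function tau_incr tau_oo.
have [A [A_derive A_per]] := periodic_antiderivative a_cont w_gt0 a_per.
move=> /(_ a_gt0); set Aw := int_period w a => Aw_gt0.
have tau_first k : (1 <= k <= p)%N -> tau k <= w.
  move=> /andP[k1 kp]; have : tau k \in `[0, w] by rewrite tau_p.
  by rewrite in_itv /= => /andP[].
have nimp_per := counting_period nimpP tau_per tau_first.
have impulse k : (1 <= k)%N -> [/\ -1 < bk k,
    forall x y, 0 < x -> 0 < y -> x <> y ->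
      bk k <= (I k x - I k y) / (x - y) <= ak k
    & forall x, 0 < x -> bk k <= I k x / x <= ak k].
  move: k; apply: (periodic_step p_gt0) => [k kp|k k1 [h1 h2 h3]].
    split; first exact: bk_gtN1.
      by move=> x y x0 y0; apply: I_lip => //; exact: ltW.
    move=> x x0; have := I_lip k kp x 0 (ltW x0) (lexx _).
    rewrite I0 ?subr0; last by case/andP: kp.
    by apply => x0'; rewrite x0' ltxx in x0.
  rewrite bk_per // ak_per //; split=> // [x y x0 y0 xy|x x0].
    by rewrite !I_per //; exact: h2.
  by rewrite I_per //; exact: h3.
have bk_gt k : (1 <= k)%N -> -1 < bk k by move=> /impulse[].
pose st k := 1 + I k (Nstar (tau k)) / Nstar (tau k).
have st_lb k : (1 <= k)%N -> 1 + bk k <= st k.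
  move=> k1; have [_ _ /(_ _ (Nstar_gt0 (tau k)))/andP[h _]] := impulse k k1.
  by rewrite lerD2l.
have lo_gt0 k : (1 <= k)%N -> 0 < 1 + bk k.
  by move=> /bk_gt; rewrite -subr_gt0 opprK addrC.
have st_gt0 k : (1 <= k)%N -> 0 < st k.
  by move=> k1; apply: lt_le_trans (st_lb k k1); exact: lo_gt0.
have st_ub k : (1 <= k)%N -> st k <= 1 + ak k.
  move=> k1; have [_ _ /(_ _ (Nstar_gt0 (tau k)))/andP[_ h]] := impulse k k1.
  by rewrite lerD2l.
have st_per k : (1 <= k)%N -> st (k + p)%N = st k.
  by move=> k1; rewrite /st tau_per // Nstar_per I_per.
have up_per k : (1 <= k)%N -> 1 + ak (k + p)%N = 1 + ak k.
  by move=> k1; rewrite ak_per.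
have NstarM j t : Nstar (t - j%:R * w) = Nstar t.
  elim: j => [|j IH]; first by rewrite mul0r subr0.
  by rewrite -IH -[in RHS](subrK w (t - _)) Nstar_per -natr1 mulrDl mul1r opprD addrA.
pose G i t := b i t * expR (- beta i t * Nstar t).
pose g t := \sum_(i < n) G i t.
have G_ge0 i t : 0 <= G i t by rewrite mulr_ge0 ?expR_ge0 // ltW.
have g_ge0 (t : R) : 0 < t -> 0 <= g t by move=> _; apply: sumr_ge0.
have Nstar_curve : impulsive_curve tau Nstar (fun t => g t - a t * Nstar t)
    (fun k => st k * Nstar (tau k)).
  apply: impulsive_curve_eq (solution_curve tau_gt0 Nstar_sol) => //.
    by move=> t; congr (_ - _); apply: eq_bigr => i _; rewrite NstarM.
  by move=> k k1; rewrite /st mulrDl mul1r divfK // gt_eqF.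
have N_curve := solution_curve tau_gt0 N_sol.
have N_gt0 (t : R) : 0 < t -> 0 < N t.
  apply: (supersolution_pos tau_incr tau_gt0 nimpP A_derive lo_gt0 N_curve).
  - move=> {}t t0 _; rewrite subrK; apply: sumr_ge0 => i _.
    by rewrite mulr_ge0 ?expR_ge0 // ltW.
  - move=> k k1 Nk; have [_ _ /(_ _ Nk)/andP[h _]] := impulse k k1.
    by rewrite mulrDl mul1r lerD2l -ler_pdivlMr.
  - apply: (@cvgr_gt _ _ _ _ _ _ N0); rewrite Nphi // in_itv /= lexx andbT.
    by rewrite oppr_le0 mulr_ge0 // ltW.
have [MN hMN] := Nst_bounded w_gt0 tau_incr tau_gt0 nimpP A_derive st_gt0
  Nstar_curve Nstar_gt0 g_ge0 (fun t _ => ltW (a_gt0 t)).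
have N_le (t : R) : 0 <= t -> Nstar t <= sup_period w Nstar.
  by apply: le_sup_period hMN _.
have [Mb hMb] : exists Mb : 'I_n -> R, forall i t, w <= t <= w + w -> beta i t <= Mb i.
  have := fun i => continuous_bounded_period w_gt0 (beta_cont i).
  by move=> /choice[Mb hMb]; exists Mb.
have ww : w <= w <= w + w by rewrite lexx lerDl ltW.
have Mb_ge0 i : 0 <= Mb i by apply: le_trans (hMb i w ww); exact: ltW.
have MN_ge0 : 0 <= MN by apply: le_trans (hMN w ww); exact: ltW.
have Mb_sum i : Mb i <= \sum_(j < n) Mb j.
  by rewrite (bigD1 i) //= lerDl sumr_ge0.
have beta_le i t : 0 <= t -> beta i t <= beta_bar w beta.
  move=> t0; apply: le_trans (@le_sup_period R w _ (\sum_(j < n) Mb j) w_gt0 _ _ t t0).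
  - exact: (le_bigmax _ (fun i => beta i t) i).
  - by move=> u; apply: eq_bigr => j _; rewrite beta_per.
  - move=> u uw; apply: bigmax_le => [|j _]; first exact: sumr_ge0.
    by apply: le_trans (hMb j u uw) _.
have betaN_le i t : 0 <= t -> beta i t * Nstar t <= betaN_bar w beta Nstar.
  move=> t0; apply: le_trans (@le_sup_period R w _ ((\sum_(j < n) Mb j) * MN) w_gt0 _ _ t t0).
  - exact: (le_bigmax _ (fun i => beta i t * Nstar t) i).
  - by move=> u; apply: eq_bigr => j _; rewrite beta_per Nstar_per.
  - move=> u uw; apply: bigmax_le => [|j _]; first by rewrite mulr_ge0 ?sumr_ge0.
    apply: ler_pM; [exact: ltW|exact: ltW| |exact: hMN].
    by apply: le_trans (hMb j u uw) _.
pose i0 := Ordinal n_gt0.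
have bN0 : 0 <= betaN_bar w beta Nstar.
  by apply: le_trans (betaN_le i0 0 (lexx _)); rewrite mulr_ge0 // ltW.
pose q1 := expR (betaN_bar w beta Nstar) - 1.
pose q2 := beta_bar w beta * sup_period w Nstar.
have q10 : 0 <= q1 by rewrite subr_ge0 -expR0 ler_expR.
have q20 : 0 <= q2.
  rewrite mulr_ge0 //; first by apply: le_trans (beta_le i0 0 (lexx _)); exact: ltW.
  by apply: le_trans (N_le 0 (lexx _)); exact: ltW.
pose e0 := expR (- Aw); pose P := \prod_(1 <= k < p.+1) st k.
pose Q := (1 - e0 ^+ mbar m) / (1 - e0) * ((1 - e0 * P) / P).
have P0 : 0 < P by exact: prod_pos.
have e0_gt0 : 0 < e0 by exact: expR_gt0.
have e0_lt1 : e0 < 1 by rewrite expR_lt1 oppr_lt0.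
have loP : \prod_(1 <= k < p.+1) (1 + bk k) <= P.
  rewrite /P big_nat [leRHS]big_nat; apply: ler_prod => k /andP[k1 _].
  by rewrite ltW ?lo_gt0 //= st_lb.
have P1 : P <= 1.
  apply: le_trans ak_prod; rewrite /P big_nat [leRHS]big_nat.
  by apply: ler_prod => k /andP[k1 _]; rewrite ltW ?st_gt0 //= st_ub.
have mi_le i : (m i <= mbar m)%N by exact: leq_bigmax.
have Q0 : 0 <= Q.
  rewrite /Q mulr_ge0 // divr_ge0 ?subr_ge0 ?(ltW P0) ?(ltW e0_lt1) //.
    by rewrite exprn_ile1 // ltW.
  by rewrite mulr_ile1 // ltW.
have gain : q1 * Q * (q2 * Q) < 1.
  apply: (@loop_gain_lt1 R (mbar m) q1 q2 e0 P (Bmax p bk)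
    (\sum_(1 <= k < p.+1) Num.min (bk k) 0)) => //.
  - by apply: leq_trans (m_gt0 i0) (mi_le i0).
  - apply: le_trans (Bmax_ge p_gt0 bk_per).
    by rewrite lef_pV2 // posrE prod_pos.
  - by apply: sumr_le0 => k _; rewrite ge_min lexx orbT.
  - by apply: le_trans loP; exact: prod1D_ge.
  - have -> : e0 ^+ mbar m = expR (- ((mbar m)%:R * Aw)).
      by rewrite /e0 -expRM_natl mulrN.
    exact: small.
(* By symmetry in X and Y this serves for x = N - N* and for - x. *)
have jump k X Y : (1 <= k)%N -> 0 < X -> 0 < Y ->
    (0 <= X - Y -> X + I k X - (Y + I k Y) <= (1 + ak k) * (X - Y)) /\
    (X - Y < 0 -> X + I k X - (Y + I k Y) < 0).
  move=> k1 X0 Y0; have [XY|XY] := eqVneq X Y.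
    by rewrite XY !subrr mulr0 ltxx.
  have [_ /(_ X Y X0 Y0 (elimN eqP XY))/andP[h1 h2] _] := impulse k k1.
  have D : X - Y != 0 by rewrite subr_eq0.
  split=> XY0.
    have {}XY0 : 0 < X - Y by rewrite lt_neqAle eq_sym D.
    by move: h2; rewrite ler_pdivrMr //; lra.
  move: h1; rewrite ler_ndivlMr // => h1.
  have := lo_gt0 k k1 => h0.
  have : 0 < (1 + bk k) * - (X - Y) by rewrite mulr_gt0 // oppr_gt0.
  by lra.
pose D := (mbar m)%:R * w.
have D0 : 0 <= D by rewrite mulr_ge0 // ltW.
have miD i : 0 < (m i)%:R * w /\ (m i)%:R * w <= D.
  by rewrite mulr_gt0 ?ltr0n // ler_pM2r // ler_nat.
pose x t := N t - Nstar t.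
pose F t := \sum_(i < n) G i t * (expR (- beta i t * x (t - (m i)%:R * w)) - 1).
have FE t : \sum_(i < n) b i t * expR (- beta i t * N (t - (m i)%:R * w)) - g t = F t.
  rewrite /g /F -sumrB; apply: eq_bigr => i _; rewrite /G mulrBr mulr1; congr (_ - _).
  rewrite -mulrA -expRD /x NstarM; congr (_ * expR _); ring.
have OSB := one_sided_bound w_gt0 tau_incr tau_gt0 tau_per nimpP nimp_per
  A_derive A_per Aw_gt0 st_gt0 st_ub st_per up_per ak_prod Nstar_curve Nstar_gt0
  Nstar_per g_ge0.
have x_curve : impulsive_curve tau x (fun t => F t - a t * x t)
    (fun k => N (tau k) + I k (N (tau k)) - (Nstar (tau k) + I k (Nstar (tau k)))).
  apply: impulsive_curve_eq (impulsive_curveD N_curve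
    (impulsive_curveZ (-1) Nstar_curve)) => [t|t|k k1].
  - by rewrite mulN1r.
  - by rewrite -FE /x; ring.
  - by rewrite /st; field; rewrite gt_eqF.
have Nx_curve := impulsive_curveZ (-1) x_curve.
have upper v T : 0 <= v <= 1 -> (forall t : R, T < t -> - x t <= v * Nstar t) ->
    forall eps : R, 0 < eps -> exists T', forall t : R, T' < t -> x t <= (q1 * Q * v + eps) * Nstar t.
  move=> v01 xT eps eps0; have /andP[v0 v1] := v01.
  pose T1 := Num.max T 0 + D + w.
  have T10 : 0 < T1 by rewrite /T1 ltr_wpDl // addr_ge0 // le_max lexx orbT.
  have past (t : R) i : T1 < t -> T < t - (m i)%:R * w.
    have [_ mi] := miD i; have : T <= Num.max T 0 by rewrite le_max lexx.
    by move=> TT; rewrite /T1 -![_ < t]subr_gt0 -subr_gt0; lra.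
  have -> : q1 * Q * v = q1 * v * Q by ring.
  apply: (OSB x _ _ x_curve _ _ (mbar m) (q1 * v) T1 eps) => //.
  - move=> k k1 xk; have [+ _] := jump k _ _ k1 (N_gt0 _ (tau_gt0 k k1)) (Nstar_gt0 (tau k)).
    exact.
  - move=> k k1 xk; have [_ +] := jump k _ _ k1 (N_gt0 _ (tau_gt0 k k1)) (Nstar_gt0 (tau k)).
    exact.
  - by rewrite mulr_ge0.
  - move=> t Tt _; rewrite subrK /F /g mulr_sumr; apply: ler_sum => i _.
    rewrite mulrC; apply: ler_wpM2r => //.
    have := xT _ (past t i Tt); rewrite NstarM => h.
    have t0 : 0 <= t by apply/ltW/(lt_trans T10).
    apply: le_trans (_ : expR (v * (beta i t * Nstar t)) - 1 <= _).
      rewrite lerD2r ler_expR mulNr -mulrN mulrCA.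
      by apply: ler_wpM2l => //; exact: ltW.
    apply: le_trans (expR_chord _ v01) _; rewrite mulrC; apply: ler_wpM2r => //.
    by rewrite lerD2r ler_expR betaN_le.
  - move=> t Tt _ pos; rewrite subrK /F; apply: sumr_le0 => i _.
    rewrite mulr_ge0_le0 // subr_le0 expR_le1 mulNr oppr_le0 mulr_ge0 ?(ltW (beta_gt0 _ _)) //.
    have [mi0 mi] := miD i.
    apply/ltW/pos; rewrite -/D; apply/andP; split; first by rewrite lerD2l lerN2.
    by rewrite gtrBl.
have lower u T : 0 <= u -> (forall t : R, T < t -> x t <= u * Nstar t) ->
    forall eps : R, 0 < eps -> exists T', forall t : R, T' < t -> - x t <= (q2 * Q * u + eps) * Nstar t.
  move=> u0 xT eps eps0.
  pose T1 := Num.max T 0 + D + w.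
  have T10 : 0 < T1 by rewrite /T1 ltr_wpDl // addr_ge0 // le_max lexx orbT.
  have past (t : R) i : T1 < t -> T < t - (m i)%:R * w.
    have [_ mi] := miD i; have : T <= Num.max T 0 by rewrite le_max lexx.
    by move=> TT; rewrite /T1 -![_ < t]subr_gt0 -subr_gt0; lra.
  have -> : q2 * Q * u = q2 * u * Q by ring.
  suff [T' hT'] : exists T', forall t : R, T' < t -> -1 * x t <= (q2 * u * Q + eps) * Nstar t.
    by exists T' => t /hT'; rewrite mulN1r.
  apply: (OSB (fun t => -1 * x t) _ _ Nx_curve _ _ (mbar m) (q2 * u) T1 eps) => //.
  - move=> k k1; rewrite !mulN1r !opprB => xk.
    have [+ _] := jump k _ _ k1 (Nstar_gt0 (tau k)) (N_gt0 _ (tau_gt0 k k1)).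
    exact.
  - move=> k k1; rewrite !mulN1r !opprB => xk.
    have [_ +] := jump k _ _ k1 (Nstar_gt0 (tau k)) (N_gt0 _ (tau_gt0 k k1)).
    exact.
  - by rewrite mulr_ge0.
  - move=> t Tt _; have -> : -1 * (F t - a t * x t) + a t * (-1 * x t) = - F t by ring.
    rewrite /F /g mulr_sumr -sumrN; apply: ler_sum => i _.
    rewrite -mulrN mulrC; apply: ler_wpM2r => //.
    have := xT _ (past t i Tt); rewrite NstarM => h.
    have t0 : 0 <= t by apply/ltW/(lt_trans T10).
    have := expR_ge1Dx (- beta i t * x (t - (m i)%:R * w)) => h1.
    have : beta i t * x (t - (m i)%:R * w) <= beta i t * (u * Nstar t).
      by apply: ler_wpM2l => //; exact: ltW.
    have : beta i t * (u * Nstar t) <= q2 * u.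
      rewrite mulrCA mulrC; apply: ler_wpM2r => //.
      by apply: ler_pM; [exact: ltW|exact: ltW|exact: beta_le|exact: N_le].
    by lra.
  - move=> t Tt _ pos; have -> : -1 * (F t - a t * x t) + a t * (-1 * x t) = - F t by ring.
    rewrite oppr_le0 /F; apply: sumr_ge0 => i _.
    rewrite mulr_ge0 // subr_ge0 -[leLHS]expR0 ler_expR mulNr oppr_ge0.
    rewrite mulr_ge0_le0 ?(ltW (beta_gt0 _ _)) //.
    have [mi0 mi] := miD i.
    rewrite -oppr_ge0 -mulN1r; apply/ltW/pos; rewrite -/D; apply/andP; split.
      by rewrite lerD2l lerN2.
    by rewrite gtrBl.
have start : exists T, forall t, T < t -> - x t <= Nstar t.
  by exists 0 => t t0; rewrite /x opprB gerBl ltW // N_gt0.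
have attract := alternating_contraction Nstar_gt0 (mulr_ge0 q10 Q0)
  (mulr_ge0 q20 Q0) gain upper lower start.
have Mpos : 0 < 1 + sup_period w Nstar.
  by rewrite ltr_pwDl // (le_trans _ (N_le 0 (lexx _))) // ltW.
apply/cvgr0Pnorm_le => eps eps0.
have [T hT] := attract (eps / (1 + sup_period w Nstar)) (divr_gt0 eps0 Mpos).
near=> t; have Tt : T < t by near: t; apply: nbhs_pinfty_gt; rewrite num_real.
have t0 : 0 <= t by near: t; apply: nbhs_pinfty_ge; rewrite num_real.
apply: le_trans (hT t Tt) _; rewrite mulrAC ler_pdivrMr // ler_pM2l //.
by apply: le_trans (N_le t t0) _; rewrite lerDr.
Unshelve. all: by end_near. Qed.
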